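(* Let $1<p<\infty$, let $a\in GL^\infty(\mathbb T)$, and let $A$ denote any one of the operators $$T(a)+H(at),\quad T(a)-H(at^{-1}),\quad T(a)+H(a),\quad T(a)-H(a)$$ acting on $H^p$ (here $t$ denotes the function $t\mapsto t$ on $\mathbb T$). Then $$\min\{\dim\ker A,\ \dim\operatorname{coker}A\}=0.$$
   Context: $\mathbb T$ is the unit circle, $L^p=L^p(\mathbb T)$, and $\hat f_n$ denotes the $n$-th Fourier coefficient. $H^p=\{f\in L^p:\hat f_n=0 \text{ for all } n<0\}$, $\overline{H^p}=\{f\in L^p:\hat f_n=0\text{ for all } n>0\}$. $P$ is the Riesz projection $\sum_n\hat f_n t^n\mapsto\sum_{n\ge0}\hat f_nt^n$ (bounded from $L^p$ onto $H^p$ for $1<p<\infty$), $Q=I-P$, $(Jf)(t)=t^{-1}f(t^{-1})$, and $\tilde a(t)=a(1/t)$. For $a\in L^\infty$ the Toeplitz operator on $H^p$ is $T(a)f=P(af)$ and the Hankel operator is $H(a)f=P(a\,QJf)$. $GL^\infty$ denotes the invertible elements of $L^\infty(\mathbb T)$. $\operatorname{coker}A$ is $H^p/\overline{\operatorname{im}A}$ (equivalently its dimension is that of the kernel of the adjoint). *)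

(* Defs.v *)
From mathcomp Require Import all_boot all_order all_algebra.
From mathcomp Require Import all_classical all_reals all_analysis.
From mathcomp Require Import complex.
Set Implicit Arguments. Unset Strict Implicit. Unset Printing Implicit Defensive.
Import Order.TTheory GRing.Theory Num.Theory.
Local Open Scope classical_set_scope.
Local Open Scope ring_scope.
Local Open Scope complex_scope.

(* Functions on the unit circle T are represented as functions C -> C
   (C = R[i]); only their values on T matter.  T is parametrized by
   theta in [0, 2 pi] via theta |-> e^{i theta}, with Lebesgue measure. *)

Section TH.
Variable R : realType.
Local Notation C := R[i].
Local Notation mu := (@lebesgue_measure R).

Definition circ_pt (x : R) : C := (cos x +i* sin x)%C.

Definition Tdom : set R := `[0, pi *+ 2].

Definition cabs (z : C) : R := Num.sqrt (complex.Re z ^+ 2 + complex.Im z ^+ 2).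

Definition cmeasurable (f : C -> C) : Prop :=
  measurable_fun Tdom (fun x => complex.Re (f (circ_pt x))) /\
  measurable_fun Tdom (fun x => complex.Im (f (circ_pt x))).

Definition lpint (p : R) (f : C -> C) : \bar R :=
  (\int[mu]_(x in Tdom) ((cabs (f (circ_pt x))) `^ p)%:E)%E.

Definition Lp (p : R) (f : C -> C) : Prop :=
  cmeasurable f /\ (lpint p f < +oo)%E.

Definition Linf (f : C -> C) : Prop :=
  cmeasurable f /\
  exists M : R, {ae mu, forall x, Tdom x -> cabs (f (circ_pt x)) <= M}.

Definition GLinf (a : C -> C) : Prop :=
  Linf a /\ exists b, Linf b /\
    {ae mu, forall x, Tdom x -> a (circ_pt x) * b (circ_pt x) = 1}.

Definition fourier (f : C -> C) (n : int) : C :=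
  ((pi *+ 2)^-1)%:C *
  ((Rintegral mu Tdom (fun x => complex.Re (f (circ_pt x) * circ_pt x ^ (- n))))%:C
   + 'i * (Rintegral mu Tdom (fun x => complex.Im (f (circ_pt x) * circ_pt x ^ (- n))))%:C).

Definition Hp (p : R) (f : C -> C) : Prop :=
  Lp p f /\ forall n : int, n < 0 -> fourier f n = 0.

Definition is_P (p : R) (f g : C -> C) : Prop :=
  Hp p g /\ forall n : int, 0 <= n -> fourier g n = fourier f n.

Definition is_Q (p : R) (f g : C -> C) : Prop :=
  Lp p g /\ (forall n : int, 0 <= n -> fourier g n = 0) /\
  (forall n : int, n < 0 -> fourier g n = fourier f n).

Definition Jop (f : C -> C) : C -> C := fun t => t^-1 * f (t^-1).

Definition Toep (p : R) (a f g : C -> C) : Prop :=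
  is_P p (fun t => a t * f t) g.

Definition Hank (p : R) (a f g : C -> C) : Prop :=
  exists q, is_Q p (Jop f) q /\ is_P p (fun t => a t * q t) g.

Definition TH_op (p : R) (a : C -> C) (s : C) (b f g : C -> C) : Prop :=
  exists g1 g2, Toep p a f g1 /\ Hank p b f g2 /\
    forall t, g t = g1 t + s * g2 t.

(* dim ker A = 0 on H^p  (equality in L^p, i.e. a.e.) *)
Definition ker_trivial (p : R) (a : C -> C) (s : C) (b : C -> C) : Prop :=
  forall f g, Hp p f -> TH_op p a s b f g -> lpint p g = 0%E -> lpint p f = 0%E.

(* dim coker A = 0, i.e. the range of A is dense in H^p *)
Definition coker_trivial (p : R) (a : C -> C) (s : C) (b : C -> C) : Prop :=
  forall h, Hp p h -> forall eps : R, 0 < eps ->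
    exists f g, Hp p f /\ TH_op p a s b f g /\
      (lpint p (fun t => (g t - h t)%R) < eps%:E)%E.

End TH.

(* Main.v *)
(** Writing [b = a t^k] and [J f (t) = t^-1 f (t^-1)], the operator acts on [H^p]
    as [A f = P (a (f + s t^k J f))].  Suppose [A f0 = 0] with [f0 <> 0]; then
    [h0 = a (f0 + s t^k J f0)] is nonzero and has only negative frequencies.  In
    each of the four cases there is a Laurent polynomial [kappa] with
    [kappa + s t^k J kappa = 0] and leading singular part [- t^-1], so that
    [f |-> t f + t^-1 f + f_0 kappa] preserves [H^p] and multiplies
    [a (f + s t^k J f)] by [t + t^-1].  Iterating from [f0] pushes the highest
    frequency of [h0] up by one at each step, hence the range of [A] contains
    every polynomial, and polynomials are dense in [H^p] by Fejer's theorem.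
    No duality and no boundedness of [P] on [L^p] is needed, only the fact that
    [P] maps [L^oo] into [L^p]: that makes the terms [P (a f)] and [P (b J f)]
    meaningful for Laurent polynomials [f]. *)
Require Import Defs.
From mathcomp Require Import all_boot all_order all_algebra.
From mathcomp Require Import all_classical all_reals all_analysis.
From mathcomp Require Import complex.
From mathcomp Require Import measurable_realfun ring lra zify.
Import Order.TTheory GRing.Theory Num.Theory.
Import numFieldNormedType.Exports.
Local Open Scope ring_scope.

Set Implicit Arguments.
Unset Strict Implicit.
Unset Printing Implicit Defensive.

(** * Normalized integrals over a period *)

Section Mean.
Local Open Scope classical_set_scope.
Local Open Scope ring_scope.
Variable R : realType.
Local Notation mu := (@lebesgue_measure R).
Local Notation E := (@Tdom R).
Implicit Types (f g h : R -> R) (c : R).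

(** Two obstacles shape the proof. First, [TH_op] is a relation: f lies in the domain only once both
    projections are exhibited, and for [f0] they come with the assumption that it is in the kernel.
    Their existence survives multiplication by t and t^-1, because a single coefficient crosses 0.
    So the iteration stays in the domain as soon as kappa lies in it, and this is what the
    projection of bounded functions is for. It is built by M. Riesz's argument: the analytic
    completion q of a Fejer mean of a bounded real function has a bounded real part, and the mean of
    q^(2k) is q(0)^(2k), which controls the even powers of the imaginary part uniformly. Second, the
    factor must commute with J, which t alone does not; t + t^-1 does. Put V f = s t^k J f, an
    involution. Then kappa is an eigenvector of V for -1, whereas h0 is nonzero because H^p contains
    no such eigenvector. This decides the signs: for k = -1, V t^-1 = s t^-1 must be - t^-1, so s =
    -1; for k = 1, V 1 = s must not be -1, so s = 1; for k = 0 both signs work. *)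

Definition aeT (P : R -> Prop) : Prop := {ae mu, forall x, E x -> P x}.
Definition intb g : Prop := mu.-integrable E (EFin \o g).
Definition mean g : R := (pi *+ 2)^-1 * Rintegral mu E g.

Lemma pi2_gt0 : 0 < pi *+ 2 :> R.
Proof. by rewrite mulrn_wgt0// pi_gt0. Qed.

Lemma pi2_neq0 : pi *+ 2 != 0 :> R.
Proof. by rewrite gt_eqF// pi2_gt0. Qed.

Lemma measurable_Tdom : measurable E.
Proof. by rewrite /Tdom; exact: measurable_itv. Qed.
Local Hint Resolve measurable_Tdom : core.

Lemma lebesgue_Tdom : mu E = (pi *+ 2)%:E.
Proof. by rewrite /Tdom lebesgue_measure_itv /= lte_fin pi2_gt0 oppr0 adde0. Qed.

Lemma intb_measurable g : intb g -> measurable_fun E g.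
Proof. by move=> /measurable_int/measurable_EFinP. Qed.

Lemma eq_intb f g : (forall x, E x -> f x = g x) -> intb f -> intb g.
Proof. by move=> fg; apply: eq_integrable => // x /set_mem Ex /=; rewrite fg. Qed.

Lemma intb_dom f g : measurable_fun E f -> (forall x, E x -> `|f x| <= g x) ->
  intb g -> intb f.
Proof.
move=> mf fg; apply: le_integrable => //; first exact/measurable_EFinP.
by move=> x Ex /=; rewrite lee_fin (le_trans (fg _ Ex))// ler_norm.
Qed.

Lemma intb_cst c : intb (fun=> c).
Proof.
apply/integrableP; split; first exact/measurable_EFinP.
by rewrite /= integral_cst// [X in (_ * X)%E]lebesgue_Tdom -EFinM ltry.
Qed.

Lemma intb_bounded f c : measurable_fun E f -> (forall x, E x -> `|f x| <= c) ->
  intb f.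
Proof. by move=> mf fc; apply: intb_dom (intb_cst c). Qed.

Lemma intbD f g : intb f -> intb g -> intb (fun x => f x + g x).
Proof. by rewrite /intb => fi gi; apply: (integrableD _ fi gi). Qed.

Lemma intbZ c f : intb f -> intb (fun x => c * f x).
Proof. by rewrite /intb => fi; apply: (integrableZl _ c fi). Qed.

Lemma intbN f : intb f -> intb (fun x => - f x).
Proof. by rewrite /intb => fi; apply: (integrableN fi). Qed.

Lemma intbB f g : intb f -> intb g -> intb (fun x => f x - g x).
Proof. by move=> fi gi; apply: intbD => //; exact: intbN. Qed.

Lemma intb_norm f : intb f -> intb (fun x => `|f x|).
Proof. exact: integrable_norm. Qed.

Lemma intb_mulb f g c : intb f -> measurable_fun E g ->
  (forall x, E x -> `|g x| <= c) -> intb (fun x => f x * g x).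
Proof.
move=> fi mg gc; apply: (@intb_dom _ (fun x => c * `|f x|)).
- by apply: measurable_funM => //; exact: intb_measurable.
- by move=> x Ex; rewrite normrM mulrC ler_wpM2r// gc.
- exact/intbZ/intb_norm.
Qed.

Lemma intb_sum I (r : seq I) (P : pred I) (F : I -> R -> R) :
  (forall i, P i -> intb (F i)) -> intb (fun x => \sum_(i <- r | P i) F i x).
Proof.
move=> Fi; elim: r => [|j r ih].
  by apply: eq_intb (intb_cst 0) => x _; rewrite big_nil.
have [Pj|nPj] := boolP (P j).
  by apply: eq_intb (intbD (Fi j Pj) ih) => x _; rewrite big_cons Pj.
by apply: eq_intb ih => x _; rewrite big_cons (negbTE nPj).
Qed.

Lemma eq_mean f g : (forall x, E x -> f x = g x) -> mean f = mean g.
Proof.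
by move=> fg; congr (_ * _); apply: eq_Rintegral => x /set_mem Ex; exact: fg.
Qed.

Lemma meanD f g : intb f -> intb g -> mean (fun x => f x + g x) = mean f + mean g.
Proof. by move=> fi gi; rewrite /mean RintegralD// mulrDr. Qed.

Lemma meanZ c f : intb f -> mean (fun x => c * f x) = c * mean f.
Proof. by move=> fi; rewrite /mean RintegralZl// mulrCA. Qed.

Lemma meanN f : intb f -> mean (fun x => - f x) = - mean f.
Proof.
by move=> fi; rewrite -mulN1r -meanZ//; apply: eq_mean => x _; rewrite mulN1r.
Qed.

Lemma meanB f g : intb f -> intb g -> mean (fun x => f x - g x) = mean f - mean g.
Proof. by move=> fi gi; rewrite meanD ?meanN//; exact: intbN. Qed.

Lemma mean_cst c : mean (fun=> c) = c.
Proof.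
rewrite /mean Rintegral_cst// [X in fine X]lebesgue_Tdom/= mulrCA mulVf ?mulr1//.
exact: pi2_neq0.
Qed.

Lemma mean_sum I (r : seq I) (P : pred I) (F : I -> R -> R) :
  (forall i, P i -> intb (F i)) ->
  mean (fun x => \sum_(i <- r | P i) F i x) = \sum_(i <- r | P i) mean (F i).
Proof.
move=> Fi; elim: r => [|j r ih].
  rewrite big_nil -[RHS](mean_cst 0); apply: eq_mean => x _.
  by rewrite big_nil.
rewrite big_cons -ih; case: ifPn => Pj.
  rewrite -meanD//; [|exact: Fi|exact: intb_sum].
  by apply: eq_mean => x _; rewrite big_cons Pj.
by apply: eq_mean => x _; rewrite big_cons (negbTE Pj).
Qed.

Lemma mean_ge0 f : (forall x, E x -> 0 <= f x) -> 0 <= mean f.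
Proof.
by move=> f0; rewrite mulr_ge0 ?invr_ge0 ?(ltW pi2_gt0)// Rintegral_ge0.
Qed.

Lemma le_mean f g : intb f -> intb g -> (forall x, E x -> f x <= g x) ->
  mean f <= mean g.
Proof.
move=> fi gi fg; rewrite ler_wpM2l ?invr_ge0 ?(ltW pi2_gt0)//.
exact: le_Rintegral.
Qed.

Lemma le_norm_mean f : intb f -> `|mean f| <= mean (fun x => `|f x|).
Proof.
move=> fi; rewrite normrM ger0_norm ?invr_ge0 ?(ltW pi2_gt0)//.
by rewrite ler_wpM2l ?invr_ge0 ?(ltW pi2_gt0)// le_normr_Rintegral.
Qed.

Lemma integral_mean f : intb f -> (\int[mu]_(x in E) (f x)%:E = (pi *+ 2 * mean f)%:E)%E.
Proof.
move=> fi; rewrite /mean mulVKf ?pi2_neq0// /Rintegral fineK//.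
exact: integrable_fin_num.
Qed.

Lemma ge0_intb f : measurable_fun E f -> (forall x, E x -> 0 <= f x) ->
  (\int[mu]_(x in E) (f x)%:E < +oo)%E -> intb f.
Proof.
move=> mf f0 fy; apply/integrableP; split; first exact/measurable_EFinP.
by under eq_integral => x /set_mem Ex do rewrite /= ger0_norm ?f0//.
Qed.

Lemma aeT_all (P : R -> Prop) : (forall x, E x -> P x) -> aeT P.
Proof. by rewrite /aeT => h; apply: aeW => x; exact: h. Qed.

Lemma ae_lebesgue_filter : Filter (almost_everywhere mu).
Proof. exact: (ae_filter_ringOfSetsType [the measure _ _ of mu]). Qed.
Local Existing Instance ae_lebesgue_filter.

Lemma aeT_imp2 (P Q S : R -> Prop) : (forall x, E x -> P x -> Q x -> S x) ->
  aeT P -> aeT Q -> aeT S.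
Proof.
rewrite /aeT => h hP hQ; apply: filterS2 hP hQ => x hP hQ Ex.
exact: h (hP Ex) (hQ Ex).
Qed.

Lemma aeT_imp (P S : R -> Prop) : (forall x, E x -> P x -> S x) -> aeT P -> aeT S.
Proof. by rewrite /aeT => h hP; apply: filterS hP => x hP Ex; exact: h (hP Ex). Qed.

Lemma ae_mean f g : measurable_fun E f -> measurable_fun E g ->
  aeT (fun x => f x = g x) -> mean f = mean g.
Proof.
rewrite /aeT => mf mg fg; congr (_ * fine _).
apply: ae_eq_integral => //; [exact/measurable_EFinP..|].
by apply: filterS fg => x fg Ex /=; rewrite fg.
Qed.

Lemma ae_intb_dom f g : measurable_fun E f -> aeT (fun x => `|f x| <= g x) ->
  intb g -> intb f.
Proof.
rewrite /aeT => mf fg gi; apply/integrableP; split; first exact/measurable_EFinP.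
have gi' := intb_norm gi.
have : (\int[mu]_(x in E) (`|g x|)%:E < +oo)%E by rewrite integral_mean// ltry.
apply: le_lt_trans; apply: ae_ge0_le_integral => //=.
- by apply/measurable_EFinP; apply: measurableT_comp.
- by apply/measurable_EFinP; apply: intb_measurable.
- by apply: filterS fg => x fg Ex /=; rewrite lee_fin (le_trans (fg Ex))// ler_norm.
Qed.

Lemma mean_eq0 f : intb f -> (forall x, E x -> 0 <= f x) ->
  mean f = 0 -> aeT (fun x => f x = 0).
Proof.
rewrite /aeT => fi f0 m0; have mf := intb_measurable fi.
have h : (\int[mu]_(x in E) `|(f x)%:E| = 0)%E.
  under eq_integral => x /set_mem Ex do rewrite /= ger0_norm ?f0//.
  by rewrite integral_mean// m0 mulr0.
have mf' : measurable_fun E (EFin \o f) by exact/measurable_EFinP.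
have [/(_ h) + _] := @ae_eq_integral_abs _ _ _ mu E measurable_Tdom _ mf'.
by apply: filterS => x /= + Ex => /(_ Ex)[].
Qed.

Lemma dominated_mean (f_ : nat -> R -> R) f g :
  (forall n, measurable_fun E (f_ n)) -> measurable_fun E f ->
  aeT (fun x => f_ ^~ x @ \oo --> f x) -> intb g ->
  (forall n x, E x -> `|f_ n x| <= g x) ->
  (fun n => mean (fun x => `|f_ n x - f x|)) @ \oo --> (0 : R).
Proof.
rewrite /aeT => mf_ mf cf gi fg.
have mf_' n : measurable_fun E (EFin \o f_ n) by exact/measurable_EFinP.
have mf' : measurable_fun E (EFin \o f) by exact/measurable_EFinP.
have cf' : {ae mu, forall x, E x -> (EFin \o f_ n) x @[n --> \oo] --> (EFin \o f) x}.
  by apply: filterS cf => x cf Ex; apply: cvg_EFin; [exact: nearW|exact: cf].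
have fg' : {ae mu, forall x n, E x -> (`|(EFin \o f_ n) x| <= (EFin \o g) x)%E}.
  by apply: aeW => x n Ex /=; rewrite lee_fin fg.
have [fi c0 _] := @dominated_convergence _ _ _ mu E measurable_Tdom _ _ _ mf_' mf' cf' gi fg'.
rewrite -[0 in X in _ --> X](mulr0 (pi *+ 2)^-1); apply: cvgMl_tmp.
by apply: fine_cvg; apply: cvg_trans c0.
Qed.

End Mean.
#[local] Hint Resolve measurable_Tdom : core.

(** * Complex means and Fourier coefficients *)

Section ComplexParts.
Local Open Scope classical_set_scope.
Local Open Scope ring_scope.
Local Open Scope complex_scope.
Variable R : realType.
Local Notation C := R[i].
Local Notation Re := (@complex.Re R).
Local Notation Im := (@complex.Im R).
Implicit Types (z w : C) (x y : R).

Lemma cReD z w : Re (z + w) = Re z + Re w. Proof. by case: z; case: w. Qed.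
Lemma cImD z w : Im (z + w) = Im z + Im w. Proof. by case: z; case: w. Qed.
Lemma cReN z : Re (- z) = - Re z. Proof. by case: z. Qed.
Lemma cImN z : Im (- z) = - Im z. Proof. by case: z. Qed.
Lemma cReM z w : Re (z * w) = Re z * Re w - Im z * Im w.
Proof. by case: z; case: w. Qed.
Lemma cImM z w : Im (z * w) = Re z * Im w + Im z * Re w.
Proof. by case: z => a b; case: w => c d /=; rewrite [b * c]mulrC. Qed.

Lemma Re_sum I (r : seq I) (P : pred I) (F : I -> C) :
  Re (\sum_(i <- r | P i) F i) = \sum_(i <- r | P i) Re (F i).
Proof. exact: (big_morph Re cReD (erefl _)). Qed.
Lemma complexP z w : Re z = Re w -> Im z = Im w -> z = w.
Proof. by case: z => a b; case: w => c d /= -> ->. Qed.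

Lemma cabs_normc z : cabs z = Normc.normc z.
Proof. by case: z. Qed.

Lemma cabs_ge0 z : 0 <= cabs z. Proof. exact: sqrtr_ge0. Qed.

Lemma cabs0 : cabs (0 : C) = 0.
Proof. by rewrite cabs_normc Normc.normc0. Qed.

Lemma cabs_eq0 z : cabs z = 0 -> z = 0.
Proof. by rewrite cabs_normc => /Normc.eq0_normc. Qed.

Lemma cabsM z w : cabs (z * w) = cabs z * cabs w.
Proof. by rewrite !cabs_normc Normc.normcM. Qed.

Lemma cabs1 : cabs (1 : C) = 1.
Proof. by rewrite cabs_normc Normc.normc1. Qed.

Lemma cabsN z : cabs (- z) = cabs z.
Proof. by rewrite !cabs_normc normcN. Qed.

Lemma cabsX z n : cabs (z ^+ n) = cabs z ^+ n.
Proof. by elim: n => [|n ih]; rewrite ?expr0 ?cabs1// !exprS cabsM ih. Qed.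

Lemma cabsD z w : cabs (z + w) <= cabs z + cabs w.
Proof. by rewrite !cabs_normc le_normcD. Qed.

Lemma cabsB z w : cabs (z - w) <= cabs z + cabs w.
Proof. by rewrite (le_trans (cabsD _ _))// cabsN. Qed.

Lemma sqr_cabs z : cabs z ^+ 2 = Re z ^+ 2 + Im z ^+ 2.
Proof. by rewrite /cabs sqr_sqrtr// addr_ge0// sqr_ge0. Qed.

Lemma cabsR x : cabs x%:C = `|x|.
Proof. by rewrite /cabs /= expr0n /= addr0 sqrtr_sqr. Qed.

Lemma Re_le_cabs z : `|Re z| <= cabs z.
Proof.
by rewrite -sqrtr_sqr ler_wsqrtr// lerDl sqr_ge0.
Qed.

Lemma Im_le_cabs z : `|Im z| <= cabs z.
Proof.
by rewrite -sqrtr_sqr ler_wsqrtr// lerDr sqr_ge0.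
Qed.

Lemma cabs_le_ReIm z : cabs z <= `|Re z| + `|Im z|.
Proof.
rewrite -[leRHS]ger0_norm ?addr_ge0// -[leRHS]sqrtr_sqr ler_wsqrtr//.
rewrite sqrrD !real_normK ?num_real// lerD2r lerDl.
by rewrite mulrn_wge0// mulr_ge0.
Qed.

Lemma cabs_sum I (r : seq I) (P : pred I) (F : I -> C) :
  cabs (\sum_(i <- r | P i) F i) <= \sum_(i <- r | P i) cabs (F i).
Proof.
elim/big_ind2: _ => [|a b c d h k|//]; first by rewrite cabs0.
by rewrite (le_trans (cabsD _ _))// lerD.
Qed.

End ComplexParts.

(** * Points of the circle and orthogonality of cos(nx), sin(nx) *)

Section Circle.
Local Open Scope classical_set_scope.
Local Open Scope ring_scope.
Local Open Scope complex_scope.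
Variable R : realType.
Local Notation C := R[i].
Implicit Types (x y : R).
Local Notation e := (@circ_pt R).

Lemma circ0 : e 0 = 1.
Proof. by rewrite /circ_pt cos0 sin0. Qed.

Lemma circD x y : e (x + y) = e x * e y.
Proof.
rewrite /circ_pt cosD sinD; apply: complexP; rewrite ?cReM ?cImM//=.
by rewrite addrC.
Qed.

Lemma cabs_circ x : cabs (e x) = 1.
Proof. by rewrite /cabs /= cos2Dsin2 sqrtr1. Qed.

Lemma circ_neq0 x : e x != 0.
Proof. by apply/eqP => h; have := cabs_circ x; rewrite h cabs0 => /eqP; rewrite eq_sym oner_eq0. Qed.

Lemma circN x : e (- x) = (e x)^-1.
Proof.
apply: (mulfI (circ_neq0 x)); rewrite divff ?circ_neq0//.
by rewrite -circD subrr circ0.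
Qed.

Lemma circX x n : e x ^+ n = e (n%:R * x).
Proof.
elim: n => [|n ih]; first by rewrite mul0r circ0.
by rewrite exprS ih -circD -natr1 mulrDl mul1r addrC.
Qed.

Lemma circXz x (n : int) : e x ^ n = e (n%:~R * x).
Proof.
case: n => n; first by rewrite -exprnP circX.
by rewrite NegzE -exprnN circX mulrNz mulNr circN.
Qed.

Lemma circ2pi x : e (x + pi *+ 2) = e x.
Proof. by rewrite /circ_pt cosD2pi sinD2pi. Qed.

Lemma conj_circ x : (e x)^* = e (- x).
Proof. by rewrite /circ_pt cosN sinN. Qed.

Lemma measurable_cosZ D (c d : R) : measurable_fun D (fun x => cos (c * x + d)).
Proof.
apply: measurable_funS (measurableT) (@subsetT _ _) _.
apply: (@measurableT_comp _ _ _ _ _ _ (@cos R)).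
  by apply: continuous_measurable_fun; exact: continuous_cos.
by apply: measurable_funD => //; apply: measurable_funM.
Qed.

Lemma measurable_sinZ D (c d : R) : measurable_fun D (fun x => sin (c * x + d)).
Proof.
apply: measurable_funS (measurableT) (@subsetT _ _) _.
apply: (@measurableT_comp _ _ _ _ _ _ (@sin R)).
  by apply: continuous_measurable_fun; exact: continuous_sin.
by apply: measurable_funD => //; apply: measurable_funM.
Qed.

Lemma sin_nat_pi2 (n : nat) : sin (n%:R * (pi *+ 2)) = 0 :> R.
Proof.
have h : e (n%:R * (pi *+ 2)) = 1.
  elim: n => [|n ih]; first by rewrite mul0r circ0.
  by rewrite -natr1 mulrDl mul1r circ2pi.
by have [] := h.
Qed.

Lemma cos_nat_pi2 (n : nat) : cos (n%:R * (pi *+ 2)) = 1 :> R.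
Proof.
have h : e (n%:R * (pi *+ 2)) = 1.
  elim: n => [|n ih]; first by rewrite mul0r circ0.
  by rewrite -natr1 mulrDl mul1r circ2pi.
by have [] := h.
Qed.

Lemma mean_FTC (f F : R -> R) : continuous f ->
  (forall x, is_derive x (1:R) F (f x)) ->
  mean f = (pi *+ 2)^-1 * (F (pi *+ 2) - F 0).
Proof.
move=> cf dF.
have cF : continuous F.
  move=> x; apply: differentiable_continuous.
  by apply/derivable1_diffP; case: (dF x).
rewrite /mean /Rintegral /Tdom (@continuous_FTC2 _ _ F) ?pi2_gt0//.
- exact: continuous_subspaceT.
- split; first by move=> x _; case: (dF x).
  + by apply: cvg_at_right_filter; exact: cF.
  + by apply: cvg_at_left_filter; exact: cF.
- by move=> x _; rewrite derive1E; case: (dF x).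
Qed.

Lemma is_derive_mulnl (n : nat) (x : R) :
  is_derive x (1:R) (fun y => n%:R * y) (n%:R : R).
Proof. by apply: is_derive_eq; rewrite /GRing.scale /= mulr1. Qed.

Lemma continuous_mulnl (n : nat) : continuous (fun y : R => n%:R * y).
Proof. by move=> x; apply: cvgMl_tmp; exact: cvg_id. Qed.

Lemma mean_cosn (n : nat) : mean (fun x : R => cos (n%:R * x)) = (n == 0%N)%:R.
Proof.
have [->|n0] := eqVneq n 0%N.
  rewrite -[RHS](mean_cst 1); apply: eq_mean => x _.
  by rewrite mul0r cos0.
have n0' : (n%:R : R) != 0 by rewrite pnatr_eq0.
have cf : continuous (fun x : R => cos (n%:R * x)).
  move=> x; apply: continuous_comp; first exact: continuous_mulnl.
  exact: continuous_cos.
have dF x : is_derive x (1:R) (fun x => n%:R^-1 * sin (n%:R * x)) (cos (n%:R * x)).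
  have d := is_derive1_comp (is_derive_sin (n%:R * x)) (is_derive_mulnl n x).
  apply: is_derive_eq (is_deriveZ n%:R^-1 d) _.
  by rewrite /GRing.scale /= mulrCA mulVf ?mulr1.
by rewrite (mean_FTC cf dF) sin_nat_pi2 !mulr0 sin0 mulr0 subrr mulr0.
Qed.

Lemma mean_sinn (n : nat) : mean (fun x : R => sin (n%:R * x)) = 0.
Proof.
have [->|n0] := eqVneq n 0%N.
  rewrite -[RHS](mean_cst 0); apply: eq_mean => x _.
  by rewrite mul0r sin0.
have n0' : (n%:R : R) != 0 by rewrite pnatr_eq0.
have cf : continuous (fun x : R => sin (n%:R * x)).
  move=> x; apply: continuous_comp; first exact: continuous_mulnl.
  exact: continuous_sin.
have dF x : is_derive x (1:R) (fun x => - n%:R^-1 * cos (n%:R * x)) (sin (n%:R * x)).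
  have d := is_derive1_comp (is_derive_cos (n%:R * x)) (is_derive_mulnl n x).
  apply: is_derive_eq (is_deriveZ (- n%:R^-1) d) _.
  by rewrite /GRing.scale /= mulNr mulNr mulrN opprK mulrCA mulVf ?mulr1.
by rewrite (mean_FTC cf dF) cos_nat_pi2 !mulr0 cos0 subrr mulr0.
Qed.

End Circle.

(** * Integration of complex-valued functions over a period *)

Section ComplexMean.
Local Open Scope classical_set_scope.
Local Open Scope ring_scope.
Local Open Scope complex_scope.
Variable R : realType.
Local Notation C := R[i].
Local Notation Re := (@complex.Re R).
Local Notation Im := (@complex.Im R).
Local Notation E := (@Tdom R).
Local Notation e := (@circ_pt R).
Implicit Types (u v : R -> C).

Definition cmeas u : Prop :=
  measurable_fun E (fun x => Re (u x)) /\ measurable_fun E (fun x => Im (u x)).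
Definition cint u : Prop := intb (fun x => Re (u x)) /\ intb (fun x => Im (u x)).
Definition cmean u : C := mean (fun x => Re (u x)) +i* mean (fun x => Im (u x)).

Lemma cmeasD u v : cmeas u -> cmeas v -> cmeas (fun x => u x + v x).
Proof.
move=> [u1 u2] [v1 v2]; split.
  by under eq_fun do rewrite cReD; exact: measurable_funD.
by under eq_fun do rewrite cImD; exact: measurable_funD.
Qed.

Lemma cmeasM u v : cmeas u -> cmeas v -> cmeas (fun x => u x * v x).
Proof.
move=> [u1 u2] [v1 v2]; split.
  by under eq_fun do rewrite cReM; apply: measurable_funB; exact: measurable_funM.
by under eq_fun do rewrite cImM; apply: measurable_funD; exact: measurable_funM.
Qed.

Lemma cmeas_cst c : cmeas (fun=> c).
Proof. by split; exact: measurable_cst. Qed.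

Lemma cmeasZ c u : cmeas u -> cmeas (fun x => c * u x).
Proof. by apply: cmeasM; exact: cmeas_cst. Qed.

Lemma cmeasN u : cmeas u -> cmeas (fun x => - u x).
Proof.
move=> [u1 u2]; split.
  by under eq_fun do rewrite cReN; exact: measurableT_comp.
by under eq_fun do rewrite cImN; exact: measurableT_comp.
Qed.

Lemma cmeasB u v : cmeas u -> cmeas v -> cmeas (fun x => u x - v x).
Proof. by move=> hu hv; apply: cmeasD => //; exact: cmeasN. Qed.

Lemma cmeas_sum I (r : seq I) (P : pred I) (F : I -> R -> C) :
  (forall i, P i -> cmeas (F i)) -> cmeas (fun x => \sum_(i <- r | P i) F i x).
Proof.
move=> mF; elim: r => [|j r ih].
  by under eq_fun do rewrite big_nil; exact: cmeas_cst.
have [Pj|nPj] := boolP (P j).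
  by under eq_fun do rewrite big_cons Pj; apply: cmeasD => //; exact: mF.
by under eq_fun do rewrite big_cons (negbTE nPj).
Qed.

Lemma cmeas_circXz (n : int) : cmeas (fun x => e x ^ n).
Proof.
split; under eq_fun do rewrite circXz -[_ * _]addr0.
  exact: measurable_cosZ.
exact: measurable_sinZ.
Qed.

Lemma measurable_cabs u : cmeas u -> measurable_fun E (fun x => cabs (u x)).
Proof.
move=> [u1 u2]; apply: (@measurableT_comp _ _ _ _ _ _ (@Num.sqrt R)).
  by apply: continuous_measurable_fun; exact: sqrt_continuous.
by apply: measurable_funD; exact: measurable_funX.
Qed.

Lemma cint_cmeas u : cint u -> cmeas u.
Proof. by move=> [u1 u2]; split; exact: intb_measurable. Qed.

Lemma eq_cint u v : (forall x, E x -> u x = v x) -> cint u -> cint v.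
Proof.
by move=> uv [u1 u2]; split;
  [apply: eq_intb u1|apply: eq_intb u2] => x Ex; rewrite uv.
Qed.

Lemma cint_cabs u : cmeas u -> intb (fun x => cabs (u x)) -> cint u.
Proof.
move=> [u1 u2] ui; split; apply: intb_dom ui => // x _.
  exact: Re_le_cabs.
exact: Im_le_cabs.
Qed.

Lemma intb_cabs u : cint u -> intb (fun x => cabs (u x)).
Proof.
move=> iu; have [u1 u2] := iu.
apply: (@intb_dom _ _ (fun x => `|Re (u x)| + `|Im (u x)|)).
- by apply: measurable_cabs; apply: cint_cmeas.
- by move=> x _; rewrite ger0_norm ?cabs_ge0// cabs_le_ReIm.
- by apply: intbD; exact: intb_norm.
Qed.

Lemma cintD u v : cint u -> cint v -> cint (fun x => u x + v x).
Proof.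
move=> [u1 u2] [v1 v2]; split.
  by apply: eq_intb (intbD u1 v1) => x _; rewrite cReD.
by apply: eq_intb (intbD u2 v2) => x _; rewrite cImD.
Qed.

Lemma cint_mulb u v (c : R) : cint u -> cmeas v ->
  (forall x, E x -> cabs (v x) <= c) -> cint (fun x => u x * v x).
Proof.
move=> iu mv vc; apply: cint_cabs; first by apply: cmeasM => //; exact: cint_cmeas.
apply: (@eq_intb _ (fun x => cabs (u x) * cabs (v x))).
  by move=> x _; rewrite cabsM.
apply: (intb_mulb (c := c)); [exact: intb_cabs|exact: measurable_cabs|].
by move=> x Ex; rewrite ger0_norm ?cabs_ge0// vc.
Qed.

Lemma cint_cst c : cint (fun=> c).
Proof. by split; exact: intb_cst. Qed.

Lemma cintZ c u : cint u -> cint (fun x => c * u x).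
Proof.
move=> iu; apply: (@eq_cint (fun x => u x * c)); first by move=> x _; rewrite mulrC.
by apply: (cint_mulb (c := cabs c)) => //; exact: cmeas_cst.
Qed.

Lemma cintN u : cint u -> cint (fun x => - u x).
Proof. by move=> iu; apply: eq_cint (cintZ (-1) iu) => x _; rewrite mulN1r. Qed.

Lemma cintB u v : cint u -> cint v -> cint (fun x => u x - v x).
Proof. by move=> iu iv; apply: cintD => //; exact: cintN. Qed.

Lemma cint_sum I (r : seq I) (P : pred I) (F : I -> R -> C) :
  (forall i, P i -> cint (F i)) -> cint (fun x => \sum_(i <- r | P i) F i x).
Proof.
move=> mF; elim: r => [|j r ih].
  by apply: eq_cint (cint_cst 0) => x _; rewrite big_nil.
have [Pj|nPj] := boolP (P j).
  by apply: eq_cint (cintD (mF j Pj) ih) => x _; rewrite big_cons Pj.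
by apply: eq_cint ih => x _; rewrite big_cons (negbTE nPj).
Qed.

Lemma cabs_circXz x (n : int) : cabs (e x ^ n) = 1.
Proof. by rewrite circXz cabs_circ. Qed.

Lemma cint_mulcirc u (n : int) : cint u -> cint (fun x => u x * e x ^ n).
Proof.
move=> iu; apply: (cint_mulb (c := 1)) => //; first exact: cmeas_circXz.
by move=> x _; rewrite cabs_circXz.
Qed.

Lemma cint_circ (n : int) : cint (fun x => e x ^ n).
Proof.
by apply: eq_cint (cint_mulcirc n (cint_cst 1)) => x _; rewrite mul1r.
Qed.

Lemma eq_cmean u v : (forall x, E x -> u x = v x) -> cmean u = cmean v.
Proof.
by move=> uv; congr Complex; apply: eq_mean => x Ex; rewrite uv.
Qed.

Lemma ae_cmean u v : cmeas u -> cmeas v -> aeT (fun x => u x = v x) ->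
  cmean u = cmean v.
Proof.
move=> [u1 u2] [v1 v2] uv; congr Complex; apply: ae_mean => //;
  by apply: aeT_imp uv => x _ ->.
Qed.

Lemma cmean_cst c : cmean (fun=> c) = c.
Proof. by rewrite /cmean !mean_cst; case: c. Qed.

Lemma cmeanD u v : cint u -> cint v -> cmean (fun x => u x + v x) = cmean u + cmean v.
Proof.
move=> [u1 u2] [v1 v2]; rewrite /cmean.
rewrite (eq_mean (fun x _ => cReD (u x) (v x))) (eq_mean (fun x _ => cImD (u x) (v x))).
by rewrite !meanD.
Qed.

Lemma cmeanZ c u : cint u -> cmean (fun x => c * u x) = c * cmean u.
Proof.
move=> [u1 u2]; rewrite /cmean.
rewrite (eq_mean (fun x _ => cReM c (u x))) (eq_mean (fun x _ => cImM c (u x))).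
rewrite meanB; [|exact: intbZ..]; rewrite meanD; [|exact: intbZ..].
by rewrite !meanZ//; apply: complexP; rewrite ?cReM ?cImM.
Qed.

Lemma cmean_sum I (r : seq I) (P : pred I) (F : I -> R -> C) :
  (forall i, P i -> cint (F i)) ->
  cmean (fun x => \sum_(i <- r | P i) F i x) = \sum_(i <- r | P i) cmean (F i).
Proof.
move=> Fi; elim: r => [|j r ih].
  rewrite big_nil -[RHS](cmean_cst 0); apply: eq_cmean => x _.
  by rewrite big_nil.
rewrite big_cons -ih; case: ifPn => Pj.
  rewrite -cmeanD//; [|exact: Fi|exact: cint_sum].
  by apply: eq_cmean => x _; rewrite big_cons Pj.
by apply: eq_cmean => x _; rewrite big_cons (negbTE Pj).
Qed.

(** The factor 2 comes from estimating real and imaginary parts separately; it only enters bounds on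
    quantities that tend to 0. *)
Lemma cabs_cmean u : cint u -> cabs (cmean u) <= 2 * mean (fun x => cabs (u x)).
Proof.
move=> iu; have [u1 u2] := iu.
rewrite (le_trans (cabs_le_ReIm _))//= mulrDl mul1r lerD//.
  rewrite (le_trans (le_norm_mean _))// le_mean//; [exact: intb_norm|exact: intb_cabs|].
  by move=> x _; exact: Re_le_cabs.
rewrite (le_trans (le_norm_mean _))// le_mean//; [exact: intb_norm|exact: intb_cabs|].
by move=> x _; exact: Im_le_cabs.
Qed.

Lemma cmean_circ (n : int) : cmean (fun x => e x ^ n) = (n == 0)%:R.
Proof.
case: n => n.
  have -> : (n%:Z == 0 :> int) = (n == 0%N) by [].
  rewrite /cmean (eq_mean (g := fun x => cos (n%:R * x))); last first.
    by move=> x _; rewrite circXz.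
  rewrite (eq_mean (f := fun x => Im _) (g := fun x => sin (n%:R * x))); last first.
    by move=> x _; rewrite circXz.
  by rewrite mean_cosn mean_sinn; case: (n == 0%N).
rewrite /cmean (eq_mean (g := fun x => cos (n.+1%:R * x))); last first.
  by move=> x _; rewrite circXz NegzE mulrNz mulNr /= cosN.
rewrite (eq_mean (f := fun x => Im _) (g := fun x => - sin (n.+1%:R * x))); last first.
  by move=> x _; rewrite circXz NegzE mulrNz mulNr /= sinN.
rewrite meanN ?mean_cosn ?mean_sinn ?oppr0//.
apply: (@eq_intb _ (fun x => - Im (e x ^ (Negz n)))); last first.
  by apply: intbN; have [] := cint_circ (Negz n).
by move=> x _; rewrite circXz NegzE mulrNz mulNr /= sinN opprK.
Qed.

End ComplexMean.

(** * Algebra of Fourier coefficients of integrable functions *)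

Section Fourier.
Local Open Scope classical_set_scope.
Local Open Scope ring_scope.
Local Open Scope complex_scope.
Variable R : realType.
Local Notation C := R[i].
Local Notation Re := (@complex.Re R).
Local Notation Im := (@complex.Im R).
Local Notation E := (@Tdom R).
Local Notation e := (@circ_pt R).
Implicit Types (f g : C -> C).

Definition L1 f : Prop := cint (fun x => f (e x)).

Lemma fourierE f n : fourier f n = cmean (fun x => f (e x) * e x ^ (- n)).
Proof.
rewrite /fourier /cmean /mean; apply: complexP;
by rewrite /= ?(mul0r, mul1r, addr0, add0r, subr0, oppr0, mulr0).
Qed.

Lemma ae_fourier f g n : cmeasurable f -> cmeasurable g ->
  aeT (fun x => f (e x) = g (e x)) -> fourier f n = fourier g n.
Proof.
move=> mf mg fg; rewrite !fourierE; apply: ae_cmean.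
- by apply: (@cmeasM _ (fun x => f (e x))) => //; exact: cmeas_circXz.
- by apply: (@cmeasM _ (fun x => g (e x))) => //; exact: cmeas_circXz.
- by apply: aeT_imp fg => x _ ->.
Qed.

Lemma eq_fourier f g n : (forall x, f (e x) = g (e x)) -> fourier f n = fourier g n.
Proof. by move=> fg; rewrite !fourierE; apply: eq_cmean => x _; rewrite fg. Qed.

Lemma fourierD f g n : L1 f -> L1 g ->
  fourier (fun t => f t + g t) n = fourier f n + fourier g n.
Proof.
move=> fi gi; rewrite !fourierE -cmeanD; [|exact: cint_mulcirc..].
by apply: eq_cmean => x _; rewrite mulrDl.
Qed.

Lemma fourierZ c f n : L1 f -> fourier (fun t => c * f t) n = c * fourier f n.
Proof.
move=> fi; rewrite !fourierE -cmeanZ; last exact: cint_mulcirc.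
by apply: eq_cmean => x _; rewrite mulrA.
Qed.

Lemma fourierN f n : L1 f -> fourier (fun t => - f t) n = - fourier f n.
Proof.
move=> fi; rewrite -mulN1r -fourierZ//; apply: eq_fourier => x.
by rewrite mulN1r.
Qed.

Lemma fourierB f g n : L1 f -> L1 g ->
  fourier (fun t => f t - g t) n = fourier f n - fourier g n.
Proof. by move=> fi gi; rewrite fourierD ?fourierN//; exact: cintN. Qed.

Lemma fourier_sum I (r : seq I) (P : pred I) (F : I -> C -> C) n :
  (forall i, P i -> L1 (F i)) ->
  fourier (fun t => \sum_(i <- r | P i) F i t) n =
  \sum_(i <- r | P i) fourier (F i) n.
Proof.
move=> Fi; under [RHS]eq_bigr do rewrite fourierE.
rewrite fourierE -cmean_sum; last by move=> i Pi; exact/cint_mulcirc/Fi.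
by apply: eq_cmean => x _; rewrite mulr_suml.
Qed.

Lemma fourier_shift f (k n : int) :
  fourier (fun t => t ^ k * f t) n = fourier f (n - k).
Proof.
rewrite !fourierE; apply: eq_cmean => x _.
rewrite mulrAC -expfzDr ?circ_neq0// mulrC; congr (_ * _ ^ _).
by rewrite opprB.
Qed.

Lemma fourier_mono (k n : int) : fourier (fun t : C => t ^ k) n = (n == k)%:R.
Proof.
rewrite fourierE (eq_cmean (v := fun x => e x ^ (k - n))); last first.
  by move=> x _; rewrite -expfzDr ?circ_neq0.
by rewrite cmean_circ subr_eq0 eq_sym.
Qed.

(** This is how convergence in L^1 passes to each single coefficient. *)
Lemma cabs_fourier f n : L1 f ->
  cabs (fourier f n) <= 2 * mean (fun x => cabs (f (e x))).
Proof.
move=> fi; rewrite fourierE (le_trans (cabs_cmean _))//.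
  exact: cint_mulcirc.
rewrite ler_wpM2l//; apply: le_mean; [exact/intb_cabs/cint_mulcirc|exact: intb_cabs|].
by move=> x _; rewrite cabsM cabs_circXz mulr1.
Qed.

End Fourier.

(** * The Fejer kernel *)

Section FejerKernel.
Local Open Scope classical_set_scope.
Local Open Scope ring_scope.
Local Open Scope complex_scope.
Variable R : realType.
Local Notation C := R[i].
Local Notation Re := (@complex.Re R).
Local Notation Im := (@complex.Im R).
Local Notation E := (@Tdom R).
Local Notation e := (@circ_pt R).
Implicit Types (g : R -> R) (u : R -> C) (N : nat).

(** The Fejer kernel as the squared modulus of a geometric sum, divided by N: nonnegativity is
    visible in this form, the trigonometric expansion is [fkerC]. *)
Definition fker N (x : R) : R := N%:R^-1 * cabs (\sum_(j < N) e x ^+ j) ^+ 2.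

Lemma fker_ge0 N x : 0 <= fker N x.
Proof. by rewrite mulr_ge0 ?invr_ge0 ?sqr_ge0. Qed.

Lemma sqr_cabsC (z : C) : (cabs z ^+ 2)%:C = z * z^*.
Proof.
rewrite sqr_cabs; case: z => a b; apply: complexP; rewrite ?cReM ?cImM /=; ring.
Qed.

Lemma fkerC N x : (fker N x)%:C =
  N%:R^-1 * \sum_(j < N) \sum_(l < N) e x ^ (j%:Z - l%:Z).
Proof.
rewrite /fker rmorphM /= fmorphV /= rmorph_nat sqr_cabsC; congr (_ * _).
rewrite rmorph_sum mulr_suml; apply: eq_bigr => j _.
rewrite mulr_sumr; apply: eq_bigr => l _.
have cj : (e x ^+ l)^* = (e x ^+ l)^-1 by rewrite circX conj_circ circN.
by rewrite [X in _ * X]cj expfzDr ?circ_neq0// -exprnN.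
Qed.

Lemma fker_le N x : fker N x <= N%:R.
Proof.
have [->|N0] := posnP N; first by rewrite /fker invr0 mul0r.
have h : cabs (\sum_(j < N) e x ^+ j) <= N%:R.
  rewrite (le_trans (cabs_sum _ _ _))//.
  under eq_bigr do rewrite circX cabs_circ.
  by rewrite sumr_const card_ord.
rewrite /fker mulrC ler_pdivrMr ?ltr0n// -expr2.
by rewrite lerXn2r// nnegrE ?cabs_ge0.
Qed.

(* (1 - z) (1 + z + ... + z^(N-1)) = 1 - z^N at z = e^{ix} *)
Lemma fker_cos_le N x : fker N x * (1 - cos x) <= 2 / N%:R.
Proof.
have h : cabs (1 - e x) ^+ 2 = 2 * (1 - cos x).
  rewrite sqr_cabs /= add0r sqrrN.
  have := cos2Dsin2 x; move: (cos x) (sin x) => c s h.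
  have -> : s ^+ 2 = 1 - c ^+ 2 by rewrite -h; ring.
  ring.
have k : cabs (1 - e x) * cabs (\sum_(j < N) e x ^+ j) <= 2.
  rewrite -cabsM -opprB mulNr -subrX1 cabsN (le_trans (cabsB _ _))//.
  by rewrite circX cabs_circ cabs1.
have k2 : cabs (1 - e x) ^+ 2 * cabs (\sum_(j < N) e x ^+ j) ^+ 2 <= 4.
  rewrite -exprMn (_ : 4 = 2 ^+ 2 :> R); last by ring.
  by rewrite lerXn2r// nnegrE ?mulr_ge0 ?cabs_ge0.
rewrite /fker -mulrA mulrC ler_wpM2r ?invr_ge0//.
move: k2; rewrite h; set D := _ ^+ 2; set c := 1 - cos x => k2; lra.
Qed.

Lemma measurable_fker N x : measurable_fun E (fun y => fker N (x - y)).
Proof.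
apply: measurable_funM => //; apply: measurable_funX.
apply: measurable_cabs; apply: cmeas_sum => j _.
have h : cmeas (fun y : R => e x ^+ j * e y ^ (- j%:Z)).
  by apply: cmeasZ; exact: cmeas_circXz.
rewrite (_ : (fun _ => _) = (fun y : R => e x ^+ j * e y ^ (- j%:Z)))//.
by apply/funext => y; rewrite circD circN exprMn exprVn exprnN.
Qed.

Definition sigma N g x : R := mean (fun y => g y * fker N (x - y)).

Lemma intb_fker N g x : intb g -> intb (fun y => g y * fker N (x - y)).
Proof.
move=> gi; apply: (intb_mulb (c := N%:R)) => //; first exact: measurable_fker.
by move=> y _; rewrite ger0_norm ?fker_ge0// fker_le.
Qed.

(** The Cesaro mean of the partial Fourier sums, kept as a sum over pairs: the frequency k = j - l
    occurs N - |k| times, which produces the Fejer weights without a case split on the sign of k. *)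
Definition cfejer N u x : C := N%:R^-1 *
  \sum_(j < N) \sum_(l < N) cmean (fun y => u y * e y ^ (- (j%:Z - l%:Z))) * e x ^ (j%:Z - l%:Z).

Lemma cfejerE N u x : cint u ->
  cfejer N u x = cmean (fun y => u y * (fker N (x - y))%:C).
Proof.
move=> ui; rewrite /cfejer.
transitivity (N%:R^-1 * \sum_(j < N) \sum_(l < N)
    cmean (fun y => u y * e (x - y) ^ (j%:Z - l%:Z))).
  congr (_ * _); apply: eq_bigr => j _; apply: eq_bigr => l _.
  rewrite mulrC -cmeanZ; last exact: cint_mulcirc.
  apply: eq_cmean => y _; rewrite mulrCA; congr (_ * _).
  by rewrite circD circN expfzMl exprz_inv.
have ci (k : int) : cint (fun y => u y * e (x - y) ^ k).
  apply: (@eq_cint _ (fun y => e x ^ k * (u y * e y ^ (- k)))).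
    by move=> y _; rewrite mulrCA circD circN expfzMl exprz_inv.
  by apply: cintZ; exact: cint_mulcirc.
under eq_bigr => j _ do (rewrite -cmean_sum; last by move=> l _; exact: ci).
rewrite -cmean_sum; last by move=> j _; apply: cint_sum => l _; exact: ci.
rewrite -cmeanZ; last by apply: cint_sum => j _; apply: cint_sum => l _; exact: ci.
apply: eq_cmean => y _; rewrite fkerC mulrCA; congr (_ * _); rewrite mulr_sumr.
by apply: eq_bigr => j _; rewrite mulr_sumr.
Qed.

Lemma Re_cfejer N u x : cint u -> Re (cfejer N u x) = sigma N (fun y => Re (u y)) x.
Proof.
move=> ui; rewrite cfejerE//.
transitivity (mean (fun y => Re (u y * (fker N (x - y))%:C))) => //.
by apply: eq_mean => y _; rewrite cReM /= mulr0 subr0.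
Qed.

Lemma Im_cfejer N u x : cint u -> Im (cfejer N u x) = sigma N (fun y => Im (u y)) x.
Proof.
move=> ui; rewrite cfejerE//.
transitivity (mean (fun y => Im (u y * (fker N (x - y))%:C))) => //.
by apply: eq_mean => y _; rewrite cImM /= mulr0 add0r.
Qed.

Lemma cint_real g : intb g -> cint (fun x => (g x)%:C).
Proof. by move=> gi; split => //=; exact: intb_cst. Qed.

Lemma sigmaE N g x : intb g -> sigma N g x = Re (cfejer N (fun x => (g x)%:C) x).
Proof. by move=> gi; rewrite Re_cfejer//; exact: cint_real. Qed.

Lemma cint_cfejer N u : cint (cfejer N u).
Proof.
by apply: cintZ; apply: cint_sum => j _; apply: cint_sum => l _; apply: cintZ; exact: cint_circ.
Qed.

Lemma intb_sigma N g : intb g -> intb (sigma N g).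
Proof.
move=> gi; have [h _] := cint_cfejer N (fun x => (g x)%:C).
by apply: eq_intb h => x _; rewrite sigmaE.
Qed.

(** The constant frequency occurs only on the diagonal j = l, that is N times. Through [mean_sigma]
    this takes the place of Fubini in the contraction estimates: the mean of a convolution with the
    kernel is found by algebra. *)
Lemma cmean_cfejer N u : (0 < N)%N -> cmean (cfejer N u) = cmean u.
Proof.
move=> N0.
have ci j l : cint (fun x => cmean (fun y => u y * e y ^ (- (j%:Z - l%:Z))) * e x ^ (j%:Z - l%:Z)).
  by apply: cintZ; exact: cint_circ.
rewrite cmeanZ; last by apply: cint_sum => j _; apply: cint_sum => l _; exact: ci.
rewrite cmean_sum; last by move=> j _; apply: cint_sum => l _; exact: ci.
transitivity (N%:R^-1 * \sum_(j < N) cmean u); last first.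
  by rewrite sumr_const card_ord -[cmean u *+ N]mulr_natl mulrA mulVf ?mul1r// pnatr_eq0 -lt0n.
congr (_ * _); apply: eq_bigr => j _.
rewrite cmean_sum; last by move=> l _; exact: ci.
under eq_bigr => l _ do (rewrite cmeanZ; last exact: cint_circ).
rewrite (bigD1 j)//= big1 ?addr0.
  rewrite cmean_circ subrr eqxx mulr1; apply: eq_cmean => x _.
  by rewrite oppr0 expr0z mulr1.
move=> l lj; rewrite cmean_circ subr_eq0.
have /negbTE -> : j%:Z != l%:Z :> int by rewrite eqz_nat eq_sym.
by rewrite mulr0.
Qed.

Lemma mean_sigma N g : (0 < N)%N -> intb g -> mean (sigma N g) = mean g.
Proof.
move=> N0 gi; have := cmean_cfejer (fun x => (g x)%:C) N0.
move=> /(congr1 Re) /= <-; apply: eq_mean => x _.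
by rewrite sigmaE.
Qed.

Lemma sigma1 N x : (0 < N)%N -> sigma N (fun=> 1) x = 1.
Proof.
move=> N0; rewrite sigmaE; last exact: intb_cst.
have h (k : int) : cmean (fun y => (1:R)%:C * e y ^ (- k)) = (k == 0)%:R.
  rewrite -oppr_eq0 -cmean_circ; apply: eq_cmean => y _.
  by rewrite mul1r.
rewrite (_ : cfejer _ _ _ = 1)// /cfejer.
transitivity (N%:R^-1 * \sum_(j < N) (1 : C)); last first.
  by rewrite sumr_const card_ord mulVf// pnatr_eq0 -lt0n.
congr (_ * _); apply: eq_bigr => j _.
rewrite (bigD1 j)//= big1 ?addr0.
  by rewrite h subrr eqxx expr0z mulr1.
move=> l lj; rewrite h subr_eq0.
have /negbTE -> : j%:Z != l%:Z :> int by rewrite eqz_nat eq_sym.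
by rewrite mul0r.
Qed.

Lemma mean_fker N x : (0 < N)%N -> mean (fun y => fker N (x - y)) = 1.
Proof.
by move=> N0; rewrite -(sigma1 x N0); apply: eq_mean => y _; rewrite mul1r.
Qed.

Lemma intb_fker1 N x : intb (fun y => fker N (x - y)).
Proof. by apply: eq_intb (intb_fker N x (intb_cst 1)) => y _; rewrite mul1r. Qed.

Lemma sigmaB N g h x : intb g -> intb h ->
  sigma N (fun y => g y - h y) x = sigma N g x - sigma N h x.
Proof.
move=> gi hi; rewrite /sigma -meanB; [|exact: intb_fker..].
by apply: eq_mean => y _; rewrite mulrBl.
Qed.

Lemma le_sigma N g h x : intb g -> intb h -> (forall y, E y -> g y <= h y) ->
  sigma N g x <= sigma N h x.
Proof.
move=> gi hi gh; apply: le_mean; [exact: intb_fker..|].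
by move=> y Ey; rewrite ler_wpM2r ?fker_ge0// gh.
Qed.

Lemma le_norm_sigma N g x : intb g ->
  `|sigma N g x| <= sigma N (fun y => `|g y|) x.
Proof.
move=> gi; rewrite (le_trans (le_norm_mean _))//; first exact: intb_fker.
rewrite le_eqVlt; apply/orP; left; apply/eqP; apply: eq_mean => y _.
by rewrite normrM [X in _ * X]ger0_norm ?fker_ge0.
Qed.

Lemma sigmaZ N c g x : intb g -> sigma N (fun y => c * g y) x = c * sigma N g x.
Proof.
move=> gi; rewrite /sigma -meanZ; last exact: intb_fker.
by apply: eq_mean => y _; rewrite mulrA.
Qed.

Lemma sigma_cst N c x : (0 < N)%N -> sigma N (fun=> c) x = c.
Proof.
move=> N0; rewrite -[RHS]mulr1 -(sigma1 x N0) -sigmaZ; last exact: intb_cst.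
by apply: eq_mean => y _; rewrite mulr1.
Qed.

Lemma sigma_bounded N g c x : (0 < N)%N -> intb g ->
  (forall y, E y -> `|g y| <= c) -> `|sigma N g x| <= c.
Proof.
move=> N0 gi gc; rewrite (le_trans (le_norm_sigma _ _ _))//.
rewrite -[leRHS](sigma_cst c x N0); apply: le_sigma => //.
  exact: intb_norm.
exact: intb_cst.
Qed.

(** Pointwise, the Fejer mean of g is dominated by that of |g|, and the latter has the same mean as
    |g|. *)
Lemma sigma_contraction N g : (0 < N)%N -> intb g ->
  mean (fun x => `|sigma N g x|) <= mean (fun x => `|g x|).
Proof.
move=> N0 gi; rewrite -[leRHS](mean_sigma N0); last exact: intb_norm.
apply: le_mean; [exact/intb_norm/intb_sigma|exact/intb_sigma/intb_norm|].
by move=> x _; exact: le_norm_sigma.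
Qed.

(** Convexity: the graph of the r-th power lies above its tangent at c. It is r times Young's
    inequality for s and c^(r-1) with exponents r and r/(r-1). *)
Lemma powR_tangent (r s c : R) : 1 < r -> 0 <= s -> 0 <= c ->
  c `^ r + r * c `^ (r - 1) * (s - c) <= s `^ r.
Proof.
move=> r1 s0 c0.
have r0 : 0 < r by rewrite (lt_trans _ r1).
have q0 : 0 < r / (r - 1) by rewrite divr_gt0// subr_gt0.
have pq : r^-1 + (r / (r - 1))^-1 = 1.
  rewrite invf_div -{1}[r^-1]mul1r -mulrDl addrC subrK divff// gt_eqF//.
have := conjugate_powR s0 (powR_ge0 c (r - 1)) r0 q0 pq.
rewrite -powRrM (_ : (r - 1) * (r / (r - 1)) = r); last first.
  by rewrite mulrCA mulfV ?mulr1// subr_eq0 gt_eqF.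
have cr : c `^ r = c `^ (r - 1) * c.
  have [->|c0'] := eqVneq c 0.
    by rewrite mulr0 powR0// gt_eqF.
  by rewrite -[X in _ * X]powRr1// -powRD ?subrK// c0' implybT.
rewrite invf_div => h.
have : r * (s * c `^ (r - 1)) <= r * (s `^ r / r + c `^ r * ((r - 1) / r)).
  by rewrite ler_wpM2l// ltW.
have -> : r * (s `^ r / r + c `^ r * ((r - 1) / r)) = s `^ r + (r - 1) * c `^ r.
  by field; rewrite gt_eqF.
rewrite cr; move: (c `^ (r - 1)) (s `^ r) => A B; lra.
Qed.

(** Jensen's inequality for the probability density [fker]: the tangent inequality at c = |sigma g
    x| is integrated, and the linear term that remains is nonnegative by [le_norm_sigma]. *)
Lemma sigma_jensen N g x (r : R) : 1 < r -> (0 < N)%N -> measurable_fun E g ->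
  intb (fun y => `|g y| `^ r) -> intb g ->
  `|sigma N g x| `^ r <= sigma N (fun y => `|g y| `^ r) x.
Proof.
move=> r1 N0 mg gr gi; have gi' := intb_norm gi.
set c := `|sigma N g x|.
have c0 : 0 <= c by rewrite normr_ge0.
have h : sigma N (fun y => c `^ r + r * c `^ (r - 1) * (`|g y| - c)) x <=
         sigma N (fun y => `|g y| `^ r) x.
  apply: le_sigma => //; last by move=> y _; exact: powR_tangent.
  apply: intbD; first exact: intb_cst.
  by apply: intbZ; apply: intbB => //; exact: intb_cst.
apply: le_trans h.
have -> : sigma N (fun y => c `^ r + r * c `^ (r - 1) * (`|g y| - c)) x =
   c `^ r + r * c `^ (r - 1) * (sigma N (fun y => `|g y|) x - c).
  have gci : intb (fun y => `|g y| - c) by apply: intbB => //; exact: intb_cst.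
  have -> : sigma N (fun y => c `^ r + r * c `^ (r - 1) * (`|g y| - c)) x =
    sigma N (fun=> c `^ r) x + sigma N (fun y => r * c `^ (r - 1) * (`|g y| - c)) x.
    rewrite /sigma -meanD; [|apply: intb_fker; exact: intb_cst|exact/intb_fker/intbZ].
    by apply: eq_mean => y _; rewrite mulrDl.
  rewrite sigma_cst// sigmaZ// sigmaB// ?sigma_cst//; exact: intb_cst.
rewrite lerDl mulr_ge0 ?subr_ge0 ?le_norm_sigma// mulr_ge0 ?powR_ge0//.
by rewrite ltW// (lt_trans _ r1).
Qed.

Lemma sigma_Lp_contraction N g (r : R) : 1 < r -> (0 < N)%N ->
  measurable_fun E g -> intb (fun y => `|g y| `^ r) -> intb g ->
  intb (fun x => `|sigma N g x| `^ r) /\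
  mean (fun x => `|sigma N g x| `^ r) <= mean (fun x => `|g x| `^ r).
Proof.
move=> r1 N0 mg gr gi.
have si : intb (fun x => `|sigma N g x| `^ r).
  apply: (@intb_dom _ _ (sigma N (fun y => `|g y| `^ r))); last exact: intb_sigma.
    apply: (measurableT_comp (measurable_powR r)).
    by apply: intb_measurable; apply: intb_norm; exact: intb_sigma.
  by move=> x _; rewrite ger0_norm ?powR_ge0// sigma_jensen.
split => //; rewrite -[leRHS](mean_sigma N0)//; apply: le_mean => //.
  exact: intb_sigma.
by move=> x _; exact: sigma_jensen.
Qed.

End FejerKernel.

(** * Convergence of Fejer means *)

Section FejerConvergence.
Local Open Scope classical_set_scope.
Local Open Scope ring_scope.
Local Open Scope complex_scope.
Variable R : realType.
Local Notation mu := (@lebesgue_measure R).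
Local Notation E := (@Tdom R).
Implicit Types (g : R -> R) (a : nat -> R).

(** Only an upper bound is asked, without absolute value: the sequences in question are built from
    means of nonnegative functions, and comparison then takes one inequality. *)
Definition tends0 a : Prop :=
  forall eps : R, 0 < eps -> exists N0 : nat, forall n, (N0 <= n)%N -> a n < eps.

Lemma cvg_tends0 a : a @ \oo --> (0 : R) -> tends0 a.
Proof.
move=> ca eps e0; move/cvgrPdist_lt : ca => /(_ eps e0)[N0 _ h].
exists N0 => n Nn; have /= := h n Nn.
by rewrite sub0r normrN; exact: le_lt_trans (ler_norm _).
Qed.

Lemma tends0_le a b : (forall n, a n <= b n) -> tends0 b -> tends0 a.
Proof.
move=> ab hb eps e0; have [N0 h] := hb eps e0.
by exists N0 => n /h; exact: le_lt_trans.
Qed.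

Lemma tends0Z a (c : R) : 0 <= c -> tends0 a -> tends0 (fun n => c * a n).
Proof.
move=> c0 ha eps e0.
have c1 : 0 < c + 1 by rewrite ltr_wpDl.
have [N0 h] := ha (eps / (c + 1)) (divr_gt0 e0 c1).
exists N0 => n /h; rewrite ltr_pdivlMr// => k.
have [a0|a0] := leP 0 (a n).
  by apply: le_lt_trans k; rewrite mulrDr mulr1 mulrC lerDl.
by apply: le_lt_trans e0; rewrite mulr_ge0_le0// ltW.
Qed.

Lemma tends0D a b : tends0 a -> tends0 b -> tends0 (fun n => a n + b n).
Proof.
move=> ha hb eps e0; have e2 : 0 < eps / 2 by rewrite divr_gt0.
have [N1 h1] := ha _ e2; have [N2 h2] := hb _ e2.
exists (maxn N1 N2) => n; rewrite geq_max => /andP[/h1 k1 /h2 k2].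
by rewrite (splitr eps) ltrD.
Qed.

(** The upper bound 2 pi - d excludes points that come close again across the end of the period. *)
Lemma cos_far (d x : R) : 0 < d -> d <= `|x| <= pi *+ 2 - d -> cos x <= cos d.
Proof.
move=> d0 /andP[dx xd].
have -> : cos x = cos `|x| by have [//|_] := ger0P x; rewrite cosN.
move: (`|x|) dx xd => {}x dx xd.
have dpi : d <= pi by move: xd dx; rewrite mulr2n => xd dx; lra.
have key y : d <= y <= pi -> cos y <= cos d.
  move=> /andP[dy ypi]; rewrite leNgt ltr_cos -?leNgt// in_itv/= ?dpi ?ypi ?andbT.
    by rewrite (le_trans (ltW d0)).
  exact: ltW.
have [xpi|xpi] := leP x pi; first by apply: key; rewrite dx.
have -> : cos x = cos (pi *+ 2 - x).
  by rewrite -cosN -cosD2pi addrC.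
by apply: key; move: xd dx xpi; rewrite mulr2n => xd dx xpi; apply/andP; split; lra.
Qed.

Lemma cos_lt1 (d : R) : 0 < d -> d <= pi -> cos d < 1.
Proof.
by move=> d0 dpi; rewrite -cos0 ltr_cos// in_itv/= ?lexx ?pi_ge0// dpi ltW.
Qed.

(** Near x the continuity of g counts; away from x the kernel is small by [fker_cos_le]. The point
    is interior because g lives on the line and may differ at 0 and 2 pi, which are the same point
    of the circle. *)
Lemma sigma_cvg_pt g (M x : R) : 0 < x < pi *+ 2 -> intb g ->
  (forall y, E y -> `|g y| <= M) -> {for x, continuous g} ->
  (fun n => sigma n.+1 g x) @ \oo --> g x.
Proof.
move=> /andP[x0 x2pi] gi gM cg.
have Ex : E x by rewrite /Tdom /= in_itv/= !ltW.
have M0 : 0 <= M by rewrite (le_trans _ (gM _ Ex)).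
apply/cvgrPdist_le => eps eps0.
have e2 : 0 < eps / 2 by rewrite divr_gt0.
move/cvgrPdist_lt : cg => /(_ _ e2) /nbhs_ballP[d0 /= d0_gt0 hd0].
(* With d below the distances of x to both ends, |x - y| is at most 2 pi - d for every y in the
   period, as [cos_far] requires. *)
pose d := Num.min d0 (Num.min x (pi *+ 2 - x)).
have d_gt0 : 0 < d by rewrite !lt_min d0_gt0 x0 subr_gt0.
have dx : d <= x by rewrite !ge_min lexx orbT.
have d2 : d <= pi *+ 2 - x by rewrite !ge_min lexx !orbT.
have dd : d <= d0 by rewrite ge_min lexx.
have dpi : d <= pi by move: dx d2; rewrite mulr2n => dx d2; lra.
pose c := 1 - cos d.
have c0 : 0 < c by rewrite subr_gt0 cos_lt1.
(* 2 M bounds |g y - g x|; the other factor bounds the kernel where 1 - cos(x - y) is at least c. *)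
pose B n := 2 * M * (2 / n.+1%:R / c).
have bnd n y : E y -> `|(g y - g x) * fker n.+1 (x - y)| <=
    eps / 2 * fker n.+1 (x - y) + B n.
  move=> Ey; rewrite normrM [X in _ * X]ger0_norm ?fker_ge0//.
  have B0 : 0 <= B n by rewrite !mulr_ge0// ?invr_ge0// ltW.
  have [xyd|xyd] := ltP `|x - y| d.
    rewrite -[leLHS]addr0 lerD// ler_wpM2r ?fker_ge0// ltW// distrC.
    by apply: hd0; rewrite /ball /= (lt_le_trans xyd).
  rewrite -[leLHS]add0r lerD//; first by rewrite mulr_ge0 ?fker_ge0// ltW.
  apply: ler_pM => //; first exact: fker_ge0.
    rewrite (le_trans (ler_normB _ _))// mulrDl mul1r lerD// gM//.
  rewrite ler_pdivlMr//; apply: le_trans (fker_cos_le _ (x - y)).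
  rewrite ler_wpM2l ?fker_ge0// lerD2l lerN2 cos_far// xyd /=.
  move: Ey; rewrite /Tdom /= in_itv/= => /andP[y0 y2].
  by rewrite ler_norml; apply/andP; split; lra.
have est n : `|g x - sigma n.+1 g x| <= eps / 2 + B n.
  have -> : g x - sigma n.+1 g x = - mean (fun y => (g y - g x) * fker n.+1 (x - y)).
    rewrite -[mean _]/(sigma n.+1 (fun y => g y - g x) x) sigmaB//.
      by rewrite sigma_cst// opprB.
    exact: intb_cst.
  have gxi : intb (fun y => g y - g x) by apply: intbB => //; exact: intb_cst.
  have i1 := intb_fker n.+1 x gxi.
  rewrite normrN (le_trans (le_norm_mean i1))//.
  have i2 : intb (fun y => eps / 2 * fker n.+1 (x - y)).
    by apply: intbZ; exact: intb_fker1.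
  apply: (@le_trans _ _ (mean (fun y => eps / 2 * fker n.+1 (x - y) + B n))).
    apply: le_mean; [exact: intb_norm|apply: intbD => //; exact: intb_cst|].
    by move=> y Ey; exact: bnd.
  rewrite meanD//; last exact: intb_cst.
  rewrite meanZ; last exact: intb_fker1.
  by rewrite mean_fker// mulr1 mean_cst.
have B0 : (fun n => B n) @ \oo --> (0 : R).
  have -> : B = (fun n => (4 * M / c) * n.+1%:R^-1).
    by apply/funext => n; rewrite /B; move: (n.+1%:R^-1) => i; field; rewrite gt_eqF.
  rewrite -[X in _ --> X](mulr0 (4 * M / c)); apply: cvgMl_tmp.
  exact: cvg_harmonic.
move/cvgrPdist_le : B0 => /(_ _ e2)[N0 _ h].
exists N0 => // n Nn /=; rewrite (le_trans (est n))// [leRHS](splitr eps) lerD2l.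
have := h n Nn; rewrite /= sub0r normrN; exact: le_trans (ler_norm _).
Qed.

Lemma aeT_interior : aeT (fun x : R => 0 < x < pi *+ 2).
Proof.
exists [set 0; pi *+ 2]; split.
- by apply: measurableU; exact: measurable_set1.
- by apply: countable_lebesgue_measure0; apply: finite_set_countable; exact: finite_set2.
- move=> x /= /not_implyP[]; rewrite /Tdom /= in_itv/= => /andP[x0 x2] h.
  have [->|xn0] := eqVneq x 0; first by left.
  right; apply/eqP; apply/negPn/negP => xn2; apply: h.
  by rewrite !lt_neqAle x0 x2 eq_sym xn0 xn2.
Qed.

(** Dominated convergence ignores the two endpoints, so continuity on the line is enough and g may
    fail to be periodic. *)
Lemma sigma_L1_continuous g : continuous g ->
  tends0 (fun n => mean (fun x => `|sigma n.+1 g x - g x|)).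
Proof.
move=> cg.
have mg : measurable_fun E g.
  by apply: measurable_funS (measurableT) (@subsetT _ _) _; exact: continuous_measurable_fun.
have [M gM] : exists M, forall y, E y -> `|g y| <= M.
  have c0 : {within `[0, (pi *+ 2 : R)], continuous (fun y => `|g y|)}.
    apply: continuous_subspaceT => y.
    by apply: continuous_comp; [exact: cg|exact: norm_continuous].
  have [c _ h] := EVT_max (ltW (pi2_gt0 R)) c0.
  by exists `|g c| => y Ey; apply: h.
have gi : intb g by apply: intb_bounded gM.
apply: cvg_tends0; apply: (@dominated_mean _ _ _ (fun=> M)) => //.
- by move=> n; apply: intb_measurable; exact: intb_sigma.
- apply: aeT_imp aeT_interior => x Ex x02.
  by apply: sigma_cvg_pt gM _ => //; exact: cg.
- exact: intb_cst.
- by move=> n x Ex; exact: sigma_bounded.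
Qed.

(** Three-epsilon argument: continuous functions are dense in L^1 and the Fejer means contract the
    L^1 norm. *)
Lemma sigma_L1 g : intb g ->
  tends0 (fun n => mean (fun x => `|sigma n.+1 g x - g x|)).
Proof.
move=> gi eps e0; pose e3 := eps / 3.
have e3_gt0 : 0 < e3 by rewrite divr_gt0.
have [h [ch hi gh]] : exists h, [/\ continuous h, intb h &
    mean (fun x => `|g x - h x|) < e3].
  have [||h_ [ch hi /fine_cvg hg]] := @approximation_continuous_integrable _ E g _ _ gi.
  - exact: measurable_Tdom.
  - by rewrite [X in (X < _)%E]lebesgue_Tdom ltry.
  have : (fun n => mean (fun x => `|g x - h_ n x|)) @ \oo --> (0 : R).
    rewrite -[0 in X in _ --> X](mulr0 (pi *+ 2)^-1); apply: cvgMl_tmp.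
    by apply: cvg_trans hg.
  move=> /cvg_tends0 /(_ _ e3_gt0)[N0 /(_ N0 (leqnn _)) hN].
  by exists (h_ N0); split => //; exact: hi.
have [N0 hN0] := sigma_L1_continuous ch e3_gt0.
exists N0 => n /hN0 hn.
have ghi : intb (fun x => g x - h x) by exact: intbB.
have s1 := sigma_contraction (ltn0Sn n) ghi.
have i1 : intb (fun x => `|sigma n.+1 (fun y => g y - h y) x|).
  by apply: intb_norm; exact: intb_sigma.
have i2 : intb (fun x => `|sigma n.+1 h x - h x|).
  by apply: intb_norm; apply: intbB => //; exact: intb_sigma.
have i3 : intb (fun x => `|g x - h x|) by exact: intb_norm.
have i12 := intbD i1 i2.
apply: (@le_lt_trans _ _ (mean (fun x => `|sigma n.+1 (fun y => g y - h y) x| +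
    `|sigma n.+1 h x - h x| + `|g x - h x|))).
  apply: le_mean; [by apply: intb_norm; apply: intbB => //; exact: intb_sigma|
     exact: intbD|].
  move=> x _; rewrite sigmaB//.
  have -> : sigma n.+1 g x - g x = (sigma n.+1 g x - sigma n.+1 h x) +
    (sigma n.+1 h x - h x) - (g x - h x) by ring.
  by rewrite (le_trans (ler_normB _ _))// lerD2r ler_normD.
rewrite meanD// meanD//.
have -> : eps = e3 + e3 + e3 by rewrite /e3; field.
by rewrite ltrD// ltrD// (le_lt_trans s1).
Qed.

(** Stands in for Minkowski's inequality; s + t is at most twice the larger term, hence the
    constant. *)
Lemma powRD_le (r s t : R) : 0 <= r -> 0 <= s -> 0 <= t ->
  (s + t) `^ r <= 2 `^ r * (s `^ r + t `^ r).
Proof.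
move=> r0; wlog st : s t / s <= t => [hw|] s0 t0.
  have /orP[st|ts] := le_total s t; first exact: hw.
  by rewrite addrC [X in _ * X]addrC; exact: hw.
apply: (@le_trans _ _ ((2 * t) `^ r)).
  by apply: ge0_ler_powR; rewrite ?nnegrE ?addr_ge0 ?mulr_ge0// mulr2n mulrDl mul1r lerD2r.
rewrite powRM// ler_wpM2l ?powR_ge0// lerDr powR_ge0//.
Qed.

(** For uniformly bounded functions this turns smallness in L^1 into smallness of the r-th
    powers. *)
Lemma powR_le_mul (r s M : R) : 1 <= r -> 0 <= s <= M -> s `^ r <= M `^ (r - 1) * s.
Proof.
move=> r1 /andP[s0 sM].
rewrite -mulr_powRB1//; last by rewrite (lt_le_trans _ r1).
rewrite mulrC ler_wpM2r//; apply: ge0_ler_powR; rewrite ?subr_ge0 ?nnegrE//.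
exact: le_trans sM.
Qed.

Lemma measurable_norm_powR g (r : R) : measurable_fun E g ->
  measurable_fun E (fun x => `|g x| `^ r).
Proof.
by move=> mg; apply: (measurableT_comp (measurable_powR r)); exact: measurableT_comp.
Qed.

Lemma sigma_Lp_bounded g (r M : R) : 1 <= r -> measurable_fun E g ->
  (forall y, E y -> `|g y| <= M) ->
  tends0 (fun n => mean (fun x => `|sigma n.+1 g x - g x| `^ r)).
Proof.
move=> r1 mg gM; have gi : intb g by apply: intb_bounded gM.
have di n : intb (fun x => `|sigma n.+1 g x - g x|).
  by apply: intb_norm; apply: intbB => //; exact: intb_sigma.
have d2 n x : E x -> `|sigma n.+1 g x - g x| `^ r <=
    (M + M) `^ (r - 1) * `|sigma n.+1 g x - g x|.
  move=> Ex; apply: powR_le_mul => //; rewrite normr_ge0/=.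
  by rewrite (le_trans (ler_normB _ _))// lerD ?gM// sigma_bounded.
have := tends0Z (powR_ge0 (M + M) (r - 1)) (sigma_L1 gi).
apply: tends0_le => n; rewrite -meanZ//.
have i2 := intbZ ((M + M) `^ (r - 1)) (di n).
apply: le_mean => //; last by move=> x Ex; exact: d2.
apply: intb_dom i2.
  apply: measurable_norm_powR; apply: intb_measurable.
  by apply: intbB => //; exact: intb_sigma.
by move=> x Ex; rewrite ger0_norm ?powR_ge0// d2.
Qed.

Lemma le_1DpowR (r s : R) : 1 <= r -> 0 <= s -> s <= 1 + s `^ r.
Proof.
move=> r1 s0; have [s1|s1] := leP s 1.
  by rewrite -[leLHS]addr0 lerD// powR_ge0.
by rewrite (le_trans (le1r_powR (ltW s1) r1))// lerDr.
Qed.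

Lemma Lp_intb g (r : R) : 1 <= r -> measurable_fun E g ->
  intb (fun x => `|g x| `^ r) -> intb g.
Proof.
move=> r1 mg gr; apply: (intb_dom mg _ (intbD (intb_cst 1) gr)) => x _.
exact: le_1DpowR.
Qed.

(** The function is cut off at a height k, fixed first so that the remainder is small in L^r. The
    remainder is then controlled by contraction for all N, and the cut-off function by
    [sigma_Lp_bounded]. *)
Lemma sigma_Lp g (r : R) : 1 < r -> measurable_fun E g ->
  intb (fun x => `|g x| `^ r) ->
  tends0 (fun n => mean (fun x => `|sigma n.+1 g x - g x| `^ r)).
Proof.
move=> r1 mg gr eps e0; have r0 : 0 <= r by rewrite ltW// (lt_trans _ r1).
have gi := Lp_intb (ltW r1) mg gr.
pose T (k : nat) x := if `|g x| <= k%:R then g x else 0.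
have mT k : measurable_fun E (T k).
  have mb : measurable_fun E (fun x => `|g x| <= k%:R).
    by apply: (@measurable_fun_ler _ _ _ E (fun x => `|g x|) (fun=> k%:R)) => //;
      exact: measurableT_comp.
  apply: (measurable_fun_if _ mb) => //; first exact: measurable_Tdom.
  by apply: (measurable_funS (@measurable_Tdom R) _ mg); exact: subIsetl.
have TK k x : `|T k x| <= k%:R by rewrite /T; case: ifP => // _; rewrite normr0.
have gT k x : `|g x - T k x| <= `|g x|.
  by rewrite /T; case: ifP => _; rewrite ?subrr ?normr0// subr0.
have gTr k x : `|g x - T k x| `^ r <= `|g x| `^ r.
  by apply: ge0_ler_powR; rewrite ?nnegrE.
have mgT k : measurable_fun E (fun x => `|g x - T k x| `^ r).
  by apply: measurable_norm_powR; exact: measurable_funB.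
have igT k : intb (fun x => `|g x - T k x| `^ r).
  by apply: intb_dom gr => // x _; rewrite ger0_norm ?powR_ge0.
have Tc : tends0 (fun k => mean (fun x => `|g x - T k x| `^ r)).
  have : (fun k => mean (fun x => `| `|g x - T k x| `^ r - 0|)) @ \oo --> (0 : R).
    apply: (@dominated_mean _ _ (fun=> 0) (fun x => `|g x| `^ r)) => //.
      apply: aeT_all => x _; have [k0 hk0] : exists k0 : nat, `|g x| <= k0%:R.
        by exists (Num.truncn `|g x|).+1; rewrite ltW// truncnS_gt.
      apply: (@cvg_near_cst _ _ _ _ _ _); exists k0 => // k /= kk0.
      rewrite /T (le_trans hk0) ?ler_nat// subrr normr0 powR0// gt_eqF//.
      by rewrite (lt_trans _ r1).
    by move=> k x _; rewrite ger0_norm ?powR_ge0.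
  move=> /cvg_tends0; apply: tends0_le => k.
  by apply: le_mean => //; [under eq_fun do rewrite subr0; exact: intb_norm|
    move=> x _; rewrite subr0 ler_norm].
set K := 2 `^ r; have K0 : 0 < K by rewrite powR_gt0.
(* Two uses of [powRD_le] bound the r-th power of a + (b + d) by K a^r + K^2 (b^r + d^r). Each of
   the three means is controlled by eps / c, and c is the sum of the coefficients. *)
pose c := K + 2 * (K * K).
have c0 : 0 < c by rewrite addr_gt0// !mulr_gt0.
have ec : 0 < eps / c by rewrite divr_gt0.
have [k /(_ k (leqnn k)) hk] := Tc _ ec.
have [N0 hN0] := sigma_Lp_bounded (ltW r1) (mT k) (fun y _ => TK k y) ec.
exists N0 => n /hN0 hn; set N := n.+1 in hn *.
have Ti : intb (T k) by apply: (@intb_bounded _ _ k%:R) => // x _; exact: TK.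
have [i1 s1] := sigma_Lp_contraction r1 (ltn0Sn n) (measurable_funB mg (mT k))
  (igT k) (intbB gi Ti).
have mS : measurable_fun E (fun x => sigma N (T k) x - T k x).
  by apply: measurable_funB => //; apply: intb_measurable; exact: intb_sigma.
have Sk x : E x -> `|sigma N (T k) x - T k x| <= k%:R + k%:R.
  move=> Ex; rewrite (le_trans (ler_normB _ _))// lerD ?TK//.
  by apply: sigma_bounded => // y _; exact: TK.
have i2 : intb (fun x => `|sigma N (T k) x - T k x| `^ r).
  apply: (@intb_bounded _ _ ((k%:R + k%:R) `^ r)); first exact: measurable_norm_powR.
  move=> x Ex; rewrite ger0_norm ?powR_ge0//.
  by apply: ge0_ler_powR; rewrite ?nnegrE ?addr_ge0// Sk.
pose F x := K * `|sigma N (fun y => g y - T k y) x| `^ r +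
  (K * K) * (`|sigma N (T k) x - T k x| `^ r + `|g x - T k x| `^ r).
have Fi : intb F by apply: intbD; apply: intbZ => //; exact: intbD.
have FE x : `|sigma N g x - g x| `^ r <= F x.
  set a := `|sigma N (fun y => g y - T k y) x|.
  set b := `|sigma N (T k) x - T k x|; set d := `|g x - T k x|.
  have h : `|sigma N g x - g x| <= a + (b + d).
    rewrite /a sigmaB//.
    have -> : sigma N g x - g x = (sigma N g x - sigma N (T k) x) +
      ((sigma N (T k) x - T k x) - (g x - T k x)) by ring.
    by rewrite (le_trans (ler_normD _ _))// lerD2l ler_normB.
  apply: (@le_trans _ _ ((a + (b + d)) `^ r)).
    apply: ge0_ler_powR h => //; rewrite nnegrE// !addr_ge0//; exact: normr_ge0.
  rewrite (le_trans (powRD_le _ _ _))//; [exact: normr_ge0|rewrite addr_ge0//; exact: normr_ge0|].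
  rewrite -/K mulrDr lerD2l -mulrA ler_wpM2l//; first exact: ltW.
  by rewrite powRD_le//; exact: normr_ge0.
apply: (@le_lt_trans _ _ (mean F)).
  apply: le_mean => //; apply: intb_dom Fi.
    apply: measurable_norm_powR; apply: measurable_funB => //.
    by apply: intb_measurable; exact: intb_sigma.
  by move=> x _; rewrite ger0_norm ?powR_ge0.
rewrite /F meanD; [|exact: intbZ|by apply: intbZ; exact: intbD].
rewrite meanZ// meanZ; last exact: intbD.
rewrite meanD//.
have -> : eps = K * (eps / c) + K * K * (eps / c + eps / c).
  by rewrite /c; field; rewrite gt_eqF.
apply: ltr_leD; first by rewrite ltr_pM2l// (le_lt_trans s1).
by rewrite ler_pM2l ?mulr_gt0// lerD// ltW.
Qed.

End FejerConvergence.

(** * Reflection of the circle, L^p spaces, uniqueness of Fourier coefficients *)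

Section Reversal.
Local Open Scope classical_set_scope.
Local Open Scope ring_scope.
Local Open Scope complex_scope.
Variable R : realType.
Local Notation mu := (@lebesgue_measure R).
Local Notation E := (@Tdom R).
Implicit Types (g : R -> R).

Let phi (x : R) : R := pi *+ 2 - x.

Let phiE x : E x -> E (phi x).
Proof.
by rewrite /Tdom /= !in_itv/= => /andP[x0 x2]; rewrite subr_ge0 x2 gerBl.
Qed.

Let phiK x : phi (phi x) = x.
Proof. by rewrite /phi opprB addrC subrK. Qed.

Let phi_preimage : phi @^-1` E = E.
Proof.
by apply/seteqP; split => x; [move=> /phiE; rewrite phiK|exact: phiE].
Qed.

Let mphi : measurable_fun setT phi.
Proof. by apply: measurable_funB. Qed.

(** The reflection x -> 2 pi - x realises t -> t^-1 on the parameter interval. It preserves the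
    length of intervals and exchanges their open and closed ends, which determines the measure. *)
Lemma lebesgue_reversal (A : set R) : measurable A ->
  pushforward mu (phi : _ -> measurableTypeR R) A = mu A.
Proof.
move=> mA; apply/esym/lebesgue_measure_unique => //= _ [[a b]] _ <-.
rewrite /pushforward.
have -> : phi @^-1` `]a, b] = `[pi *+ 2 - b, pi *+ 2 - a[%classic.
  apply/seteqP; split => x /=; rewrite !in_itv/= /phi => /andP[h1 h2];
  by apply/andP; split; lra.
rewrite !lebesgue_measure_itv/= !lte_fin ltrD2l ltrN2.
by case: ifP => // _; rewrite -!EFinB; congr EFin; ring.
Qed.

Lemma measurable_reversal g : measurable_fun E g ->
  measurable_fun E (fun x => g (pi *+ 2 - x)).
Proof.
move=> mg; apply: (@measurable_comp _ _ _ _ _ _ E g E phi) => //.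
- exact: measurable_Tdom.
- by move=> _ [x Ex <-]; exact: phiE.
- exact: measurable_funS measurableT (@subsetT _ _) mphi.
Qed.

Lemma ge0_integral_reversal g : measurable_fun E g -> (forall x, E x -> 0 <= g x) ->
  (\int[mu]_(x in E) (g (pi *+ 2 - x))%:E = \int[mu]_(x in E) (g x)%:E)%E.
Proof.
move=> mg g0.
transitivity (\int[pushforward mu (phi : _ -> measurableTypeR R)]_(x in E) (g x)%:E)%E; last first.
  by apply: eq_measure_integral => //= A mA AS; exact: lebesgue_reversal.
rewrite ge0_integral_pushforward//=.
- by rewrite phi_preimage.
- exact: measurable_Tdom.
- exact/measurable_EFinP.
- by move=> x /set_mem Ex; rewrite lee_fin g0.
Qed.

Lemma intb_reversal g : intb g -> intb (fun x => g (pi *+ 2 - x)).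
Proof.
move=> gi; have mg := intb_measurable gi; have gi' := intb_norm gi.
have mn : measurable_fun E (fun x => `|g x|) by exact: intb_measurable.
apply/integrableP; split; first by apply/measurable_EFinP; exact: measurable_reversal.
under eq_integral do rewrite /=.
by rewrite (ge0_integral_reversal mn)// integral_mean// ltry.
Qed.

Lemma mean_reversal g : intb g -> mean (fun x => g (pi *+ 2 - x)) = mean g.
Proof.
have pos (h : R -> R) : intb h -> (forall x, 0 <= h x) -> mean (fun x => h (pi *+ 2 - x)) = mean h.
  move=> hi h0; rewrite /mean /Rintegral.
  by rewrite (ge0_integral_reversal (intb_measurable hi) (fun x _ => h0 x)).
move=> gi; have gi' := intb_norm gi; have si := intbD gi gi'.
have s0 x : 0 <= g x + `|g x| by rewrite addrC -lerBlDr sub0r -normrN ler_norm.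
(* Writing g as (g + |g|) - |g| reduces to nonnegative integrable functions. *)
have -> : mean g = mean (fun x => g x + `|g x|) - mean (fun x => `|g x|).
  by rewrite meanD// addrK.
rewrite -(pos _ si s0) -(pos _ gi' (fun x => normr_ge0 _)) -meanB.
- by apply: eq_mean => x _; rewrite addrK.
- exact: (intb_reversal si).
- exact: (intb_reversal gi').
Qed.

End Reversal.

(** * L^p on the circle, complex Fejer means, uniqueness of coefficients *)

Section Spaces.
Local Open Scope classical_set_scope.
Local Open Scope ring_scope.
Local Open Scope complex_scope.
Variable R : realType.
Local Notation C := R[i].
Local Notation Re := (@complex.Re R).
Local Notation Im := (@complex.Im R).
Local Notation mu := (@lebesgue_measure R).
Local Notation E := (@Tdom R).
Local Notation e := (@circ_pt R).
Implicit Types (f g a : C -> C) (p : R).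

Lemma measurable_cabs_powR (u : R -> C) p : cmeas u ->
  measurable_fun E (fun x => cabs (u x) `^ p).
Proof.
by move=> mu_; apply: (measurableT_comp (measurable_powR p)); exact: measurable_cabs.
Qed.

Lemma Lp_intbP p f : Lp p f <->
  cmeas (fun x => f (e x)) /\ intb (fun x => cabs (f (e x)) `^ p).
Proof.
split=> [[mf fy]|[mf fi]]; split => //.
  apply: ge0_intb => //; first exact: measurable_cabs_powR.
  by move=> x _; exact: powR_ge0.
by rewrite /lpint integral_mean// ltry.
Qed.

Lemma lpint_mean p f : Lp p f ->
  lpint p f = (pi *+ 2 * mean (fun x => cabs (f (e x)) `^ p))%:E.
Proof. by move=> /Lp_intbP[_ fi]; exact: integral_mean. Qed.

Lemma Lp_L1 p f : 1 <= p -> Lp p f -> L1 f.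
Proof.
move=> p1 /Lp_intbP[mf fi]; apply: cint_cabs => //.
apply: (intb_dom (measurable_cabs mf) _ (intbD (intb_cst 1) fi)) => x _.
by rewrite ger0_norm ?cabs_ge0// le_1DpowR ?cabs_ge0.
Qed.

Lemma ae_Lp_le p f g (c : R) : 0 <= p -> 0 <= c -> cmeas (fun x => f (e x)) -> Lp p g ->
  aeT (fun x => cabs (f (e x)) <= c * cabs (g (e x))) -> Lp p f.
Proof.
move=> p0 c0 mf /Lp_intbP[_ gi] fg; apply/Lp_intbP; split => //.
have := intbZ (c `^ p) gi.
apply: ae_intb_dom; first exact: measurable_cabs_powR.
apply: aeT_imp fg => x _ h; rewrite ger0_norm ?powR_ge0//.
rewrite -powRM ?cabs_ge0//.
by apply: ge0_ler_powR; rewrite ?nnegrE ?mulr_ge0 ?cabs_ge0.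
Qed.

Lemma Lp_le p f g : 0 <= p -> cmeas (fun x => f (e x)) -> Lp p g ->
  (forall x, cabs (f (e x)) <= cabs (g (e x))) -> Lp p f.
Proof.
move=> p0 mf gp fg; apply: (ae_Lp_le p0 ler01 mf gp); apply: aeT_all => x _.
by rewrite mul1r.
Qed.

Lemma LpD p f g : 0 <= p -> Lp p f -> Lp p g -> Lp p (fun t => f t + g t).
Proof.
move=> p0 /Lp_intbP[mf fi] /Lp_intbP[mg gi]; apply/Lp_intbP.
have m := cmeasD mf mg; split; first exact: m.
apply: (intb_dom _ _ (intbZ (2 `^ p) (intbD fi gi))).
  exact: measurable_cabs_powR.
move=> x _; rewrite ger0_norm ?powR_ge0//.
apply: le_trans (powRD_le p0 (cabs_ge0 _) (cabs_ge0 _)).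
by apply: ge0_ler_powR; rewrite ?nnegrE ?addr_ge0 ?cabs_ge0// cabsD.
Qed.

Lemma LpZ p c f : 0 <= p -> Lp p f -> Lp p (fun t => c * f t).
Proof.
move=> p0 fp; apply: (ae_Lp_le p0 (cabs_ge0 c) _ fp).
  by apply: cmeasZ; case: fp.
by apply: aeT_all => x _; rewrite cabsM.
Qed.

Lemma LpB p f g : 0 <= p -> Lp p f -> Lp p g -> Lp p (fun t => f t - g t).
Proof.
move=> p0 fp gp; apply: (LpD p0 fp).
apply: (Lp_le p0 _ (LpZ (-1) p0 gp)).
  by apply: (@cmeasN _ (fun x => g (e x))); case: gp.
by move=> x; rewrite mulN1r.
Qed.

Lemma Lp_shift p (k : int) f : 0 <= p -> Lp p f -> Lp p (fun t => t ^ k * f t).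
Proof.
move=> p0 fp; apply: (Lp_le p0 _ fp).
  apply: (@cmeasM _ (fun x => e x ^ k) (fun x => f (e x))); first exact: cmeas_circXz.
  by case: fp.
by move=> x; rewrite cabsM cabs_circXz mul1r.
Qed.

Lemma Lp_cst p c : Lp p (fun=> c).
Proof. by apply/Lp_intbP; split; [exact: cmeas_cst|exact: intb_cst]. Qed.

Lemma Lp_mono p (k : int) : 0 <= p -> Lp p (fun t => t ^ k).
Proof.
move=> p0; apply: (Lp_le p0 _ (@Lp_cst p 1)); first exact: cmeas_circXz.
by move=> x; rewrite cabs_circXz cabs1.
Qed.

Lemma Lp_mul_inf p a f : 0 <= p -> Linf a -> Lp p f -> Lp p (fun t => a t * f t).
Proof.
move=> p0 [ma [M aM]] fp.
apply: (@ae_Lp_le _ _ f `|M|) => //; first by apply: (@cmeasM _ (fun x => a (e x)) (fun x => f (e x))) => //; case: fp.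
apply: aeT_imp aM => x _ h; rewrite cabsM ler_wpM2r ?cabs_ge0//.
by rewrite (le_trans h)// ler_norm.
Qed.

Lemma Linf_Lp p a : 0 <= p -> Linf a -> Lp p a.
Proof.
move=> p0 ai; apply: (Lp_le p0 _ (Lp_mul_inf p0 ai (@Lp_cst p 1))).
  by case: ai.
by move=> x; rewrite mulr1.
Qed.

Lemma Linf_mono_mul a (k : int) : Linf a -> Linf (fun t => a t * t ^ k).
Proof.
move=> [ma [M aM]]; split.
  by apply: (@cmeasM _ (fun x => a (e x))) => //; exact: cmeas_circXz.
by exists M; apply: aeT_imp aM => x _ h; rewrite cabsM cabs_circXz mulr1.
Qed.

Lemma Lp_reversal p f : Lp p f -> Lp p (fun t => f t^-1).
Proof.
have cE x : (e x)^-1 = e (pi *+ 2 - x).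
  by rewrite -circN addrC circ2pi.
move=> /Lp_intbP[[m1 m2] fi]; apply/Lp_intbP; split.
  split; under eq_fun do rewrite cE.
    exact: (measurable_reversal m1).
  exact: (measurable_reversal m2).
by under eq_fun do rewrite cE; exact: (intb_reversal fi).
Qed.

Lemma fourier_reversal f n : L1 f -> fourier (fun t => f t^-1) n = fourier f (- n).
Proof.
move=> fi; rewrite !fourierE.
have [i1 i2] := cint_mulcirc (- (- n)) fi.
rewrite /cmean -(mean_reversal i1) -(mean_reversal i2).
have h x : f (e x)^-1 * e x ^ (- n) = f (e (pi *+ 2 - x)) * e (pi *+ 2 - x) ^ (- (- n)).
  have -> : e (pi *+ 2 - x) = (e x)^-1 by rewrite addrC circ2pi circN.
  by rewrite exprz_inv opprK.
by congr Complex; apply: eq_mean => x _; rewrite h.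
Qed.

Lemma lpint0P p f : 0 < p -> Lp p f ->
  lpint p f = 0%E <-> aeT (fun x => f (e x) = 0).
Proof.
move=> p0 fp; have [mf fi] := (Lp_intbP p f).1 fp.
rewrite lpint_mean//; split.
  move=> /eqP; rewrite eqe mulf_eq0 (negbTE (pi2_neq0 R)) /= => /eqP m0.
  have := mean_eq0 fi (fun x _ => powR_ge0 _ _) m0.
  apply: aeT_imp => x _ /powR_eq0_eq0; exact: cabs_eq0.
move=> f0; rewrite (@ae_mean _ _ (fun=> 0)) ?mean_cst ?mulr0//.
  exact: measurable_cabs_powR.
by apply: aeT_imp f0 => x _ ->; rewrite cabs0 powR0// gt_eqF.
Qed.

Lemma Lp_sum p I (r : seq I) (P : pred I) (F : I -> C -> C) : 0 <= p ->
  (forall i, P i -> Lp p (F i)) -> Lp p (fun t => \sum_(i <- r | P i) F i t).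
Proof.
move=> p0 Fp; elim: r => [|j r ih].
  by under eq_fun do rewrite big_nil; exact: Lp_cst.
have [Pj|nPj] := boolP (P j).
  by under eq_fun do rewrite big_cons Pj; exact: (LpD p0 (Fp j Pj) ih).
by under eq_fun do rewrite big_cons (negbTE nPj); exact: ih.
Qed.

(** [cfejer] as a function of the point t, so that [fourier] and [Lp] apply to it. *)
Definition fejer N f (t : C) : C := N%:R^-1 *
  \sum_(j < N) \sum_(l < N) fourier f (j%:Z - l%:Z) * t ^ (j%:Z - l%:Z).

Lemma fejer_cfejer N f x : fejer N f (e x) = cfejer N (fun y => f (e y)) x.
Proof.
congr (_ * _); apply: eq_bigr => j _; apply: eq_bigr => l _.
by rewrite fourierE.
Qed.

Lemma Lp_fejer p N f : 0 <= p -> Lp p (fejer N f).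
Proof.
move=> p0; apply: (LpZ _ p0); apply: (Lp_sum _ p0) => j _; apply: (Lp_sum _ p0) => l _.
exact: (LpZ _ p0 (Lp_mono _ p0)).
Qed.

Lemma fejer_L1 f : L1 f ->
  tends0 (fun n => mean (fun x => cabs (fejer n.+1 f (e x) - f (e x)))).
Proof.
move=> fi; have [i1 i2] := fi.
have := tends0D (sigma_L1 i1) (sigma_L1 i2); apply: tends0_le => n.
have j1 : intb (fun x => `|sigma n.+1 (fun y => Re (f (e y))) x - Re (f (e x))|).
  by apply: intb_norm; apply: intbB => //; exact: intb_sigma.
have j2 : intb (fun x => `|sigma n.+1 (fun y => Im (f (e y))) x - Im (f (e x))|).
  by apply: intb_norm; apply: intbB => //; exact: intb_sigma.
rewrite -meanD//; apply: le_mean; last first.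
- move=> x _; rewrite fejer_cfejer (le_trans (cabs_le_ReIm _))//.
  by rewrite cReD cReN cImD cImN Re_cfejer// Im_cfejer.
- exact: intbD.
- apply: intb_cabs; apply: cintB => //.
  by apply: eq_cint (cint_cfejer n.+1 (fun y => f (e y))) => x _; rewrite fejer_cfejer.
Qed.

Lemma fejer_Lp p f : 1 < p -> Lp p f ->
  tends0 (fun n => mean (fun x => cabs (fejer n.+1 f (e x) - f (e x)) `^ p)).
Proof.
move=> p1 fp; have p0 : 0 <= p by rewrite ltW// (lt_trans _ p1).
have fi := Lp_L1 (ltW p1) fp; have [i1 i2] := fi.
have [[m1 m2] fpi] := (Lp_intbP p f).1 fp.
have k1 : intb (fun x => `|Re (f (e x))| `^ p).
  apply: intb_dom fpi; first exact: measurable_norm_powR.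
  move=> x _; rewrite ger0_norm ?powR_ge0//.
  by apply: ge0_ler_powR; rewrite ?nnegrE ?cabs_ge0// Re_le_cabs.
have k2 : intb (fun x => `|Im (f (e x))| `^ p).
  apply: intb_dom fpi; first exact: measurable_norm_powR.
  move=> x _; rewrite ger0_norm ?powR_ge0//.
  by apply: ge0_ler_powR; rewrite ?nnegrE ?cabs_ge0// Im_le_cabs.
have := tends0Z (powR_ge0 2 p) (tends0D (sigma_Lp p1 m1 k1) (sigma_Lp p1 m2 k2)).
apply: tends0_le => n.
have ci : cint (fun x => fejer n.+1 f (e x) - f (e x)).
  apply: cintB => //.
  by apply: eq_cint (cint_cfejer n.+1 (fun y => f (e y))) => x _; rewrite fejer_cfejer.
have lpd := LpB p0 (Lp_fejer n.+1 f p0) fp.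
have sig u : intb u -> measurable_fun E (fun x => `|sigma n.+1 u x - u x| `^ p).
  move=> ui; apply: measurable_norm_powR; apply: intb_measurable.
  by apply: intbB => //; exact: intb_sigma.
have [_ lpdi] := (Lp_intbP p _).1 lpd.
have q1 : intb (fun x => `|sigma n.+1 (fun y => Re (f (e y))) x - Re (f (e x))| `^ p).
  apply: intb_dom lpdi; first exact: sig.
  move=> x _; rewrite ger0_norm ?powR_ge0//.
  apply: ge0_ler_powR; rewrite ?nnegrE ?cabs_ge0//.
  rewrite (le_trans _ (Re_le_cabs _))// fejer_cfejer cReD cReN.
  by rewrite Re_cfejer.
have q2 : intb (fun x => `|sigma n.+1 (fun y => Im (f (e y))) x - Im (f (e x))| `^ p).
  apply: intb_dom lpdi; first exact: sig.
  move=> x _; rewrite ger0_norm ?powR_ge0//.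
  apply: ge0_ler_powR; rewrite ?nnegrE ?cabs_ge0//.
  rewrite (le_trans _ (Im_le_cabs _))// fejer_cfejer cImD cImN.
  by rewrite Im_cfejer.
have q12 := intbD q1 q2.
rewrite -meanD// -meanZ//; apply: le_mean => //; first exact: intbZ.
move=> x _; apply: le_trans (powRD_le p0 (normr_ge0 _) (normr_ge0 _)).
apply: ge0_ler_powR; rewrite ?nnegrE ?addr_ge0 ?cabs_ge0//.
rewrite fejer_cfejer (le_trans (cabs_le_ReIm _))//.
by rewrite cReD cReN cImD cImN Re_cfejer// Im_cfejer.
Qed.

(** Vanishing coefficients make every Fejer mean vanish on the circle, while these means converge to
    f in L^1. *)
Lemma fourier_uniq f : L1 f -> (forall n, fourier f n = 0) ->
  aeT (fun x => f (e x) = 0).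
Proof.
move=> fi f0.
have z N x : fejer N f (e x) = 0.
  by rewrite /fejer big1 ?mulr0// => j _; rewrite big1// => l _; rewrite f0 mul0r.
have m0 : mean (fun x => cabs (f (e x))) = 0.
  apply/eqP; rewrite eq_le; apply/andP; split; last first.
    by apply: mean_ge0 => x _; exact: cabs_ge0.
  rewrite leNgt; apply/negP => /(fejer_L1 fi)[N /(_ N (leqnn N))].
  rewrite (@eq_mean _ _ (fun x => cabs (f (e x)))) ?ltxx// => x _.
  by rewrite z sub0r cabsN.
have := mean_eq0 (intb_cabs fi) (fun x _ => cabs_ge0 _) m0.
by apply: aeT_imp => x _; exact: cabs_eq0.
Qed.

Lemma fourier_inj f g : L1 f -> L1 g -> (forall n, fourier f n = fourier g n) ->
  aeT (fun x => f (e x) = g (e x)).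
Proof.
move=> fi gi fg.
have h : aeT (fun x => f (e x) - g (e x) = 0).
  apply: (@fourier_uniq (fun t => f t - g t)); first exact: cintB.
  by move=> n; rewrite fourierB// fg subrr.
by apply: aeT_imp h => x _ /eqP; rewrite subr_eq0 => /eqP.
Qed.

Lemma fourier_fejer N f n : fourier (fejer N f) n =
  N%:R^-1 * \sum_(j < N) \sum_(l < N) fourier f n *+ (n == j%:Z - l%:Z).
Proof.
have mi (k : int) c : L1 (fun t => c * t ^ k) by apply: cintZ; exact: cint_circ.
rewrite /fejer fourierZ; last by apply: cint_sum => j _; apply: cint_sum => l _; exact: mi.
rewrite fourier_sum; last by move=> j _; apply: cint_sum => l _; exact: mi.
congr (_ * _); apply: eq_bigr => j _.
rewrite fourier_sum; last by move=> l _; exact: mi.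
apply: eq_bigr => l _; rewrite fourierZ; last exact: cint_circ.
rewrite fourier_mono; have [<-|] := eqVneq; first by rewrite mulr1.
by rewrite mulr0.
Qed.

Lemma fourier_fejer0 N f n : fourier f n = 0 -> fourier (fejer N f) n = 0.
Proof.
move=> f0; rewrite fourier_fejer big1 ?mulr0// => j _; rewrite big1// => l _.
by rewrite f0 mul0rn.
Qed.

Lemma fourier_fejer_high N f n : N%:Z <= n -> fourier (fejer N f) n = 0.
Proof.
move=> Nn; rewrite fourier_fejer big1 ?mulr0// => j _; rewrite big1// => l _.
have [h|//] := eqVneq.
have : N%:Z <= j%:Z.
  by rewrite (le_trans Nn)// h gerBl.
by rewrite lez_nat leqNgt ltn_ord.
Qed.

End Spaces.

(** * Powers of analytic polynomials *)

Section PolynomialMean.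
Local Open Scope classical_set_scope.
Local Open Scope ring_scope.
Local Open Scope complex_scope.
Variable R : realType.
Local Notation C := R[i].
Local Notation Re := (@complex.Re R).
Local Notation Im := (@complex.Im R).
Local Notation E := (@Tdom R).
Local Notation e := (@circ_pt R).
Implicit Types (q : {poly C}) (M u v : R).

Lemma cint_horner q : cint (fun x => q.[e x]).
Proof.
apply: (@eq_cint _ (fun x => \sum_(i < size q) q`_i * e x ^ i)).
  by move=> x _; rewrite horner_coef; apply: eq_bigr.
by apply: cint_sum => i _; apply: cintZ; exact: cint_circ.
Qed.

Lemma fourier_horner q (n : int) : fourier (fun t => q.[t]) n =
  if n is Posz k then q`_k else 0.
Proof.
rewrite (@eq_fourier _ _ (fun t => \sum_(i < size q) q`_i * t ^ (i : nat)%:Z)); last first.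
  by move=> x; rewrite horner_coef; apply: eq_bigr.
rewrite fourier_sum; last by move=> i _; apply: cintZ; exact: cint_circ.
under eq_bigr => i _ do (rewrite fourierZ; last exact: cint_circ).
under eq_bigr do rewrite fourier_mono.
case: n => n; last by rewrite big1// => i _; rewrite mulr0.
have [nq|nq] := ltnP n (size q); last first.
  rewrite nth_default// big1// => i _; rewrite eqz_nat.
  by have [ni|] := eqVneq n i; rewrite ?mulr0//; move: nq; rewrite ni leqNgt ltn_ord.
rewrite (bigD1 (Ordinal nq))//= eqxx mulr1 big1 ?addr0// => i.
rewrite -val_eqE /= => ni; rewrite eqz_nat eq_sym.
by rewrite (negbTE ni) mulr0.
Qed.

Lemma cmean_horner q : cmean (fun x => q.[e x]) = q.[0].
Proof.
rewrite horner_coef0 -[RHS](fourier_horner q 0%N) fourierE.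
by apply: eq_cmean => x _; rewrite oppr0 expr0z mulr1.
Qed.

(** The mean of q^2 is q(0)^2 = 0, and Re(q^2) = (Re q)^2 - (Im q)^2. This is the L^2 isometry of
    harmonic conjugation. *)
Lemma mean_sqr_Im q : q.[0] = 0 ->
  mean (fun x => Im q.[e x] ^+ 2) = mean (fun x => Re q.[e x] ^+ 2).
Proof.
move=> q0.
have bnd (T : C -> R) : (T = Re \/ T = Im) -> intb (fun x => T q.[e x] ^+ 2).
  move=> hT.
  have qi : cint (fun x => (q * q).[e x]) by exact: cint_horner.
  have := intb_cabs qi; apply: intb_dom.
    apply: measurable_funX; have [m1 m2] := cint_cmeas (cint_horner q).
    by case: hT => ->.
  move=> x _; rewrite hornerM cabsM -expr2 normrX.
  rewrite lerXn2r ?nnegrE ?cabs_ge0//.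
  by case: hT => ->; [exact: Re_le_cabs|exact: Im_le_cabs].
have r := bnd Re (or_introl erefl); have i := bnd Im (or_intror erefl).
apply/eqP; rewrite eq_sym -subr_eq0 -meanB//; apply/eqP.
have := cmean_horner (q * q); rewrite hornerM q0 mulr0 => /(congr1 Re) /= <-.
by apply: eq_mean => x _; rewrite hornerM cReM !expr2.
Qed.

Lemma cabs_subXX (z w : C) (B : R) n : cabs z <= B -> cabs w <= B ->
  cabs (z ^+ n.+1 - w ^+ n.+1) <= cabs (z - w) * (n.+1%:R * B ^+ n).
Proof.
move=> zB wB; rewrite subrXX cabsM ler_wpM2l ?cabs_ge0//.
have B0 : 0 <= B by rewrite (le_trans (cabs_ge0 z)).
rewrite (le_trans (cabs_sum _ _ _))//.
apply: (@le_trans _ _ (\sum_(i < n.+1) B ^+ n)); last first.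
  by rewrite sumr_const card_ord mulr_natl.
apply: ler_sum => i _; rewrite cabsM !cabsX /=.
rewrite -[X in _ <= _ ^+ X](@subnK i n) 1?leq_ord// exprD.
by rewrite ler_pM ?exprn_ge0 ?cabs_ge0// lerXn2r ?nnegrE ?cabs_ge0.
Qed.

(* With z = u + i v close to the imaginary axis, (-1)^k z^(2k) = (v - i u)^(2k)
   is a perturbation of v^(2k). *)
Lemma conjugate_power_bound M k : 0 <= M -> exists B : R,
  forall u v, `|u| <= M ->
    v ^+ (2 * k.+1) <= 2 * ((-1) ^+ k.+1 * Re ((u +i* v) ^+ (2 * k.+1))) + B.
Proof.
move=> M0; set n := (2 * k.+1)%N.
have nS : n = n.-1.+1 by rewrite /n mulnS.
(* Beyond L the error term is absorbed: the summand n M 2^n makes it at most half of v^n, and the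
   summand M ensures M <= |v|. Up to L the error is at most A. *)
pose L : R := n%:R * M * 2 ^+ n + M.
pose A : R := n%:R * M * (M + L) ^+ n.-1.
have L0 : 0 <= L by rewrite addr_ge0// !mulr_ge0// exprn_ge0.
have A0 : 0 <= A by rewrite !mulr_ge0// exprn_ge0// addr_ge0.
exists (2 * A) => u v uM.
have eqz : (-1) ^+ k.+1 * Re ((u +i* v) ^+ n) = Re ((v -i* u) ^+ n).
  have -> : (u +i* v) = 'i * (v -i* u) :> C.
    by apply: complexP; rewrite ?cReM ?cImM /=; ring.
  rewrite exprMn /n exprM sqr_i.
  have -> : (-1 : C) ^+ k.+1 = ((-1 : R) ^+ k.+1)%:C by rewrite rmorphXn /= rmorphN1.
  rewrite cReM /= mul0r subr0 mulrA -exprMn mulrNN mulr1 expr1n mul1r.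
  by [].
rewrite eqz.
have vE : v%:C ^+ n = (v ^+ n)%:C by rewrite rmorphXn.
have key : v ^+ n - n%:R * M * (M + `|v|) ^+ n.-1 <= Re ((v -i* u) ^+ n).
  have cz : cabs (v -i* u) <= M + `|v|.
    by rewrite (le_trans (cabs_le_ReIm _))//= normrN addrC lerD2r.
  have cv : cabs v%:C <= M + `|v| by rewrite cabsR lerDr.
  have := @cabs_subXX (v -i* u) v%:C _ n.-1 cz cv.
  rewrite -nS vE => h.
  have d : cabs ((v -i* u) - v%:C) <= M.
    rewrite (_ : (v -i* u) - v%:C = 0 -i* u); last first.
      by apply: complexP; rewrite ?cReD ?cImD ?cReN ?cImN /= ?subrr ?subr0 ?oppr0 ?addr0.
    by rewrite (le_trans (cabs_le_ReIm _))//= normr0 add0r normrN.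
  have h2 : cabs ((v -i* u) ^+ n - (v ^+ n)%:C) <= n%:R * M * (M + `|v|) ^+ n.-1.
    rewrite (le_trans h)// [n%:R * M]mulrC -mulrA ler_wpM2r// mulr_ge0// exprn_ge0//.
    by rewrite addr_ge0.
  have := le_trans (Re_le_cabs _) h2; rewrite cReD cReN /= ler_norml => /andP[h3 _].
  by rewrite addrC -lerBrDr.
suff : v ^+ n <= 2 * (v ^+ n - n%:R * M * (M + `|v|) ^+ n.-1) + 2 * A.
  by move=> h; apply: (le_trans h); rewrite lerD2r ler_wpM2l.
suff : n%:R * M * (M + `|v|) ^+ n.-1 <= v ^+ n / 2 + A by lra.
have vn0 : 0 <= v ^+ n by rewrite /n exprM exprn_ge0// sqr_ge0.
have [vL|vL] := leP `|v| L.
  rewrite -[leLHS]add0r lerD ?divr_ge0// ler_wpM2l ?mulr_ge0//.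
  apply: lerXn2r; last by rewrite lerD2l.
  - by rewrite nnegrE addr_ge0.
  - by rewrite nnegrE (addr_ge0 M0 L0).
rewrite -[leLHS]addr0 lerD//.
have Mv : M <= `|v|.
  by rewrite (le_trans _ (ltW vL))// lerDr !mulr_ge0// exprn_ge0.
apply: (@le_trans _ _ (n%:R * M * (2 * `|v|) ^+ n.-1)).
  rewrite ler_wpM2l ?mulr_ge0//; apply: lerXn2r.
  - by rewrite nnegrE addr_ge0.
  - by rewrite nnegrE mulr_ge0.
  - by rewrite mulrDl mul1r lerD2r.
have -> : v ^+ n = `|v| * `|v| ^+ n.-1.
  by rewrite -exprS -nS -normrX ger0_norm.
have e2 : 2 ^+ n = 2 * 2 ^+ n.-1 :> R by rewrite {1}nS exprS.
have h : n%:R * M * (2 * 2 ^+ n.-1) <= `|v|.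
  by rewrite -e2 (le_trans _ (ltW vL))// lerDl.
have V0 : 0 <= `|v| ^+ n.-1 by rewrite exprn_ge0.
have := ler_wpM2r V0 h; rewrite exprMn.
move: (_ ^+ n.-1) (_ ^+ n.-1) (n%:R * M) => P V K; lra.
Qed.

(** M. Riesz's argument: as the mean of q^n is q(0)^n, integrating [conjugate_power_bound] bounds
    the even powers of Im q through q(0) and Re q alone, uniformly over all polynomials. *)
Lemma mean_Im_power M k : 0 <= M -> forall A : R, exists B : R, forall q,
  cabs q.[0] <= A -> (forall x, `|Re q.[e x]| <= M) ->
  intb (fun x => Im q.[e x] ^+ (2 * k.+1)) /\
  mean (fun x => Im q.[e x] ^+ (2 * k.+1)) <= B.
Proof.
move=> M0 A; have [B hB] := conjugate_power_bound k M0.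
set n := (2 * k.+1)%N.
exists (2 * A ^+ n + B) => q qA qM.
have [ri _] := cint_horner (q ^+ n).
have ii : intb (fun x => Im q.[e x] ^+ n).
  have := intb_cabs (cint_horner (q ^+ n)); apply: intb_dom.
    apply: measurable_funX; by have [_] := cint_cmeas (cint_horner q).
  move=> x _; rewrite horner_exp cabsX normrX lerXn2r ?nnegrE ?cabs_ge0//.
  exact: Im_le_cabs.
split => //.
have si := intbZ ((-1) ^+ k.+1) ri.
have s2 := intbZ 2 si.
apply: (@le_trans _ _ (mean (fun x => 2 * ((-1) ^+ k.+1 * Re (q ^+ n).[e x]) + B))).
  apply: le_mean => //; first by apply: intbD => //; exact: intb_cst.
  move=> x _; rewrite horner_exp; have := hB _ (Im q.[e x]) (qM x).
  by rewrite -/n; case: (q.[e x]).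
rewrite meanD//; last exact: intb_cst.
rewrite mean_cst lerD2r meanZ// ler_wpM2l// meanZ//.
have -> : mean (fun x => Re (q ^+ n).[e x]) = Re (q.[0] ^+ n).
  by have /(congr1 Re) /= := cmean_horner (q ^+ n); rewrite horner_exp.
rewrite (le_trans (ler_norm _))// normrM normrX normrN1 expr1n mul1r.
rewrite (le_trans (Re_le_cabs _))// cabsX lerXn2r ?nnegrE ?cabs_ge0//.
by rewrite (le_trans (cabs_ge0 _) qA).
Qed.

End PolynomialMean.

(** * Analytic completion of the Fejer means of a bounded real function *)

Section ConjugatePolynomial.
Local Open Scope classical_set_scope.
Local Open Scope ring_scope.
Local Open Scope complex_scope.
Variable R : realType.
Local Notation C := R[i].
Local Notation Re := (@complex.Re R).
Local Notation Im := (@complex.Im R).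
Local Notation E := (@Tdom R).
Local Notation e := (@circ_pt R).
Variables (a : C -> C) (M : R).
Hypothesis ma : cmeas (fun x => a (e x)).
Hypothesis a_real : forall x, Im (a (e x)) = 0.
Hypothesis aM : forall x, `|Re (a (e x))| <= M.

Let iRe : intb (fun x => Re (a (e x))).
Proof. by have [m1 _] := ma; apply: (intb_bounded (c := M)). Qed.

Let ai : L1 a.
Proof.
split => //; apply: eq_intb (intb_cst 0) => x _; exact/esym/a_real.
Qed.

Lemma cReRM (r : R) (w : C) : Re (r%:C * w) = r * Re w.
Proof. by case: w => u v /=; rewrite mul0r subr0. Qed.

Lemma fourier_real_conj n : fourier a (- n) = (fourier a n)^*.
Proof.
rewrite !fourierE /cmean /= -meanN; last by have [] := cint_mulcirc (- n) ai.
have h x : a (e x) * e x ^ (- - n) = (a (e x) * e x ^ (- n))^*.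
  rewrite rmorphM /=; congr (_ * _).
    by have := a_real x; case: (a (e x)) => r i /= ->; rewrite oppr0.
  rewrite !circXz; apply: complexP; rewrite /circ_pt /= !(mulrNz, mulNr, opprK, cosN, sinN)//.
by congr Complex; apply: eq_mean => x _; rewrite h; case: (_ * _).
Qed.

(* Analytic completion of the Fejer mean: its real part on the circle is the
   mean itself, its imaginary part the conjugate function. *)
Definition conj_poly N : {poly C} :=
  (2 / N%:R) *: (\sum_(j < N) \sum_(l < N | (l <= j)%N)
    fourier a (j - l)%N *: 'X^(j - l)) - (fourier a 0)%:P.

Lemma horner_conj_poly N t : (conj_poly N).[t] =
  2 / N%:R * (\sum_(j < N) \sum_(l < N | (l <= j)%N)
    fourier a (j - l)%N * t ^+ (j - l)) - fourier a 0.
Proof.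
rewrite /conj_poly hornerD hornerN hornerC hornerZ horner_sum.
congr (_ * _ - _); apply: eq_bigr => j _.
by rewrite horner_sum; apply: eq_bigr => l _; rewrite hornerZ hornerXn.
Qed.

Lemma conj_poly0 N : (0 < N)%N -> (conj_poly N).[0] = fourier a 0.
Proof.
move=> N0; rewrite horner_conj_poly.
have -> : \sum_(j < N) \sum_(l < N | (l <= j)%N)
    fourier a (j - l)%N * 0 ^+ (j - l) = \sum_(j < N) fourier a 0.
  apply: eq_bigr => j _; rewrite (bigD1 j)//= subnn expr0 mulr1 big1 ?addr0//.
  move=> l /andP[lj ljn]; rewrite expr0n subn_eq0.
  have /negbTE -> : ~~ (j <= l)%N.
    by rewrite -ltnNge ltn_neqAle lj -val_eqE /= in ljn *; rewrite ljn.
  by rewrite mulr0.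
rewrite sumr_const card_ord -[X in _ * X]mulr_natl mulrA divfK; last by rewrite pnatr_eq0 -lt0n.
by rewrite mulrDl mul1r addrK.
Qed.

(** For real a the summands at (j, l) and (l, j) are conjugate, so the real part of the full double
    sum is twice that of the triangle l <= j minus that of the diagonal. Hence the factor 2 and the
    subtracted constant in [conj_poly]. *)
Lemma Re_conj_poly N x : (0 < N)%N ->
  Re (conj_poly N).[e x] = sigma N (fun y => Re (a (e y))) x.
Proof.
move=> N0; rewrite -(@Re_cfejer _ N (fun y => a (e y)))// -fejer_cfejer horner_conj_poly.
pose z (j l : nat) := fourier a (j%:Z - l%:Z) * e x ^ (j%:Z - l%:Z).
have zC j l : Re (z j l) = Re (z l j).
  rewrite /z -[l%:Z - j%:Z]opprB fourier_real_conj.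
  have -> : e x ^ (- (j%:Z - l%:Z)) = (e x ^ (j%:Z - l%:Z))^*.
    by rewrite !circXz mulrNz mulNr conj_circ.
  by move: (fourier a _) (e x ^ _) => [p q] [r s] /=; rewrite mulrNN.
have zz j : z j j = fourier a 0 by rewrite /z subrr expr0z mulr1.
pose D := \sum_(j < N) \sum_(l < N | (l <= j)%N) Re (z j l).
have Dall : \sum_(j < N) \sum_(l < N) Re (z j l) = 2 * D - N%:R * Re (fourier a 0).
  have -> : 2 * D - N%:R * Re (fourier a 0) = D + (D - N%:R * Re (fourier a 0)).
    by ring.
  have -> : D - N%:R * Re (fourier a 0) = \sum_(j < N) \sum_(l < N | (l < j)%N) Re (z j l).
    have -> : N%:R * Re (fourier a 0) = \sum_(j < N) Re (fourier a 0).
      by rewrite sumr_const card_ord mulr_natl.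
    rewrite /D -sumrB; apply: eq_bigr => j _.
    rewrite (bigD1 j)//= zz addrAC subrr add0r; apply: eq_bigl => l.
    by rewrite ltn_neqAle andbC.
  have -> : \sum_(j < N) \sum_(l < N | (l < j)%N) Re (z j l) =
            \sum_(j < N) \sum_(l < N | ~~ (l <= j)%N) Re (z j l).
    rewrite (exchange_big_dep predT)//=; apply: eq_bigr => j _.
    by apply: eq_big => l; [rewrite -ltnNge|rewrite zC].
  rewrite /D -big_split /=; apply: eq_bigr => j _.
  by rewrite (bigID (fun l : 'I_N => (l <= j)%N)).
have nN : N%:R != 0 :> R by rewrite pnatr_eq0 -lt0n.
have cN : (N%:R^-1 : C) = (N%:R^-1)%:C by rewrite fmorphV /= rmorph_nat.
rewrite /fejer cN cReD cReN [in RHS]cReRM.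
have -> : 2 * (N%:R^-1)%:C = (2 / N%:R : R)%:C :> C.
  by rewrite rmorphM /= rmorph_nat.
rewrite cReRM !Re_sum.
have -> : \sum_(j < N) Re (\sum_(l < N | (l <= j)%N) fourier a (j - l)%N * e x ^+ (j - l)) = D.
  apply: eq_bigr => j _; rewrite Re_sum; apply: eq_bigr => l lj.
  by rewrite /z subzn.
have -> : \sum_(j < N) Re (\sum_(l < N) fourier a (j%:Z - l%:Z) * e x ^ (j%:Z - l%:Z)) =
    \sum_(j < N) \sum_(l < N) Re (z j l).
  by apply: eq_bigr => j _; rewrite Re_sum.
by rewrite Dall; field.
Qed.

(** As N grows these coefficients tend to 2 a_n for n > 0 and to a_0 for n = 0, from which
    [riesz_real] recovers the projection. *)
Lemma fourier_conj_poly N (n : nat) : (0 < N)%N ->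
  fourier (fun t => (conj_poly N).[t]) n =
  2 * fourier (fejer N a) n - fourier a 0 *+ (n == 0%N).
Proof.
move=> N0; rewrite fourier_horner fourier_fejer /conj_poly.
rewrite coefB coefZ coefC coef_sum; congr (_ - _); last by case: (n == 0%N).
rewrite -mulrA; congr (_ * (_ * _)); apply: eq_bigr => j _.
rewrite coef_sum big_mkcond /=; apply: eq_bigr => l _.
rewrite coefZ coefXn; case: leqP => lj.
  by rewrite subzn// eqz_nat; have [->|] := eqVneq; rewrite ?mulr1// mulr0.
have [h|//] := eqVneq.
have : (j%:Z - l%:Z < 0)%R by rewrite subr_lt0 ltz_nat.
by rewrite -h.
Qed.

End ConjugatePolynomial.

(** * Almost everywhere limits *)

Section FastLimit.
Local Open Scope classical_set_scope.
Local Open Scope ring_scope.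
Local Open Scope complex_scope.
Variable R : realType.
Local Notation C := R[i].
Local Notation Re := (@complex.Re R).
Local Notation Im := (@complex.Im R).
Local Notation mu := (@lebesgue_measure R).
Local Notation E := (@Tdom R).
Local Notation e := (@circ_pt R).
Lemma cvg_cabs (z : nat -> C) (l : C) :
  (fun j => Re (z j)) @ \oo --> Re l ->
  (fun j => Im (z j)) @ \oo --> Im l ->
  (fun j => cabs (z j)) @ \oo --> cabs l.
Proof.
rewrite /cabs; move: (Re l) (Im l) => a b ca cb.
have h : (fun j => Re (z j) ^+ 2 + Im (z j) ^+ 2) @ \oo --> a ^+ 2 + b ^+ 2.
  have hX (u : nat -> R) (c : R) : u @ \oo --> c -> (fun j => u j ^+ 2) @ \oo --> c ^+ 2.
    by move=> uc; under eq_fun do rewrite expr2; rewrite expr2; exact: cvgM.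
  by apply: cvgD; exact: hX.
exact: (continuous_cvg _ (@sqrt_continuous _ _) h).
Qed.

Variable w : nat -> C -> C.
Hypothesis wi : forall j, L1 (w j).
Hypothesis dw : forall j, mean (fun x => cabs (w j.+1 (e x) - w j (e x))) <= 2 ^- j.

(* Where the increments are not summable the sequence is replaced by 0, so that
   it converges everywhere and its limit is measurable. *)
Let P n t : R := \sum_(j < n) cabs (w j.+1 t - w j t).
Let S t : \bar R := ereal_sup (range (fun n => (P n t)%:E)).
Let good t : bool := S t \is a fin_num.
Let v j t : C := if good t then w j t else 0.

Let Pnd t : nondecreasing_seq (fun n => (P n t)%:E).
Proof.
by apply/nondecreasing_seqP => n; rewrite lee_fin /P big_ord_recr /= lerDl cabs_ge0.
Qed.

Let PS t : (fun n => (P n t)%:E) @ \oo --> S t.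
Proof. exact: ereal_nondecreasing_cvgn. Qed.

Let P_le_S n t : ((P n t)%:E <= S t)%E.
Proof. by apply: ereal_sup_ubound; exists n. Qed.

Let S_ge0 t : (0 <= S t)%E.
Proof. by apply: le_trans (P_le_S 0 t); rewrite lee_fin /P big_ord0. Qed.

Let iP n : intb (fun x => P n (e x)).
Proof. by apply: intb_sum => j _; apply: intb_cabs; apply: cintB; exact: wi. Qed.

Let mS : measurable_fun E (fun x => S (e x)).
Proof.
apply: (emeasurable_fun_cvg (fun n x => (P n (e x))%:E)); last by move=> x _; exact: PS.
by move=> n; apply/measurable_EFinP; exact: intb_measurable.
Qed.

Let geom n : \sum_(j < n) (2 ^- j : R) <= 2.
Proof.
suff -> : \sum_(j < n) (2 ^- j : R) = 2 - 2 * 2 ^- n.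
  by rewrite gerBl mulr_ge0// invr_ge0 exprn_ge0.
elim: n => [|n ih]; first by rewrite big_ord0 expr0 invr1 mulr1 subrr.
rewrite big_ord_recr /= ih exprS invfM mulrA divff// mul1r; ring.
Qed.

(** Monotone convergence for the partial sums [P], whose means are bounded by the geometric series
    [geom]. *)
Let intS : (\int[mu]_(x in E) S (e x) < +oo)%E.
Proof.
apply: (@le_lt_trans _ _ (pi *+ 2 * 2)%:E); last exact: ltry.
have cv := @cvg_monotone_convergence _ _ _ mu E (@measurable_Tdom R)
  (fun n x => (P n (e x))%:E).
have -> : (\int[mu]_(x in E) S (e x) =
    \int[mu]_(x in E) limn (fun n => (P n (e x))%:E))%E.
  by apply: eq_integral => x _; apply/esym/cvg_lim => //; exact: PS.
have bnd n : (\int[mu]_(x in E) (P n (e x))%:E <= (pi *+ 2 * 2)%:E)%E.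
  rewrite integral_mean// lee_fin ler_wpM2l ?(ltW (pi2_gt0 R))//.
  rewrite /P mean_sum; last by move=> j _; apply: intb_cabs; apply: cintB; exact: wi.
  by apply: le_trans (geom n); apply: ler_sum => j _; exact: dw.
have {}cv : (fun n => \int[mu]_(x in E) (P n (e x))%:E)%E @ \oo -->
  (\int[mu]_(x in E) limn (fun n => (P n (e x))%:E))%E.
  apply: cv.
  - by move=> n; apply/measurable_EFinP; exact: intb_measurable.
  - by move=> n x _; rewrite lee_fin; apply: sumr_ge0 => j _; exact: cabs_ge0.
  - by move=> x _; exact: Pnd.
rewrite -(cvg_lim _ cv)//; apply: lime_le; first by apply/cvg_ex; eexists; exact: cv.
by apply: nearW.
Qed.

Let iS : mu.-integrable E (fun x => S (e x)).
Proof.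
apply/integrableP; split => //.
by under eq_integral do rewrite gee0_abs//.
Qed.

Let ae_good : aeT (fun x => good (e x)).
Proof. exact: (@integrable_ae _ _ _ mu E (@measurable_Tdom R) _ iS). Qed.

Let ifS : intb (fun x => fine (S (e x))).
Proof.
apply: le_integrable iS => //; first exact: measurable_Tdom.
  by apply/measurable_EFinP; apply: (measurableT_comp _ mS); exact: fine_measurable.
move=> x _ /=; have := S_ge0 (e x); case: (S (e x)) => [r| |]//= _.
by rewrite normr0 leey.
Qed.

Let mgood : measurable_fun E (fun x => good (e x)).
Proof.
apply: (measurable_fun_bool true).
exact: (emeasurable_fin_num (@measurable_Tdom R) mS).
Qed.

Let cmeas_v j : cmeas (fun x => v j (e x)).
Proof.
have [m1 m2] := cint_cmeas (wi j).
split.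
  have -> : (fun x => Re (v j (e x))) = (fun x => if good (e x) then Re (w j (e x)) else 0).
    by apply/funext => x; rewrite /v; case: ifP.
  apply: (measurable_fun_if _ mgood) => //; first exact: measurable_Tdom.
  by apply: (measurable_funS (@measurable_Tdom R) _ m1); exact: subIsetl.
have -> : (fun x => Im (v j (e x))) = (fun x => if good (e x) then Im (w j (e x)) else 0).
  by apply/funext => x; rewrite /v; case: ifP.
apply: (measurable_fun_if _ mgood) => //; first exact: measurable_Tdom.
by apply: (measurable_funS (@measurable_Tdom R) _ m2); exact: subIsetl.
Qed.

(** u is its first term plus a telescoping series that converges absolutely. *)
Let bounded_increments (u : nat -> R) (B : R) :
  (forall n, \sum_(j < n) `|u j.+1 - u j| <= B) -> cvgn u.
Proof.
move=> uB.
have h : cvgn (series (telescope u)).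
  apply: normed_cvg.
  have -> : [normed series (telescope u)] = (fun n => \sum_(j < n) `|u j.+1 - u j|).
    by apply/funext => n; rewrite /normed_series_of /series /= big_mkord.
  apply: nondecreasing_is_cvgn; last by exists B => _ [n _ <-]; exact: uB.
  by apply/nondecreasing_seqP => n; rewrite big_ord_recr /= lerDl.
have -> : u = (fun n => u 0%N + series (telescope u) n).
  by apply/funext => n; rewrite -eq_sum_telescope.
by apply: is_cvgD => //; exact: is_cvg_cst.
Qed.

Let Pfine t n : good t -> P n t <= fine (S t).
Proof. by move=> gt; rewrite -lee_fin fineK. Qed.

Let cvg_part (T : C -> R) t : (forall z y, T (z - y) = T z - T y) ->
  (forall z, `|T z| <= cabs z) -> T 0 = 0 -> cvgn (fun j => T (v j t)).
Proof.
move=> TB Tc T0; rewrite /v; case gt: (good t); last exact: is_cvg_cst.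
apply: (@bounded_increments _ (fine (S t))) => n.
apply: le_trans (Pfine n gt); apply: ler_sum => j _.
by rewrite -TB Tc.
Qed.

Let cReB (z y : C) : Re (z - y) = Re z - Re y. Proof. by rewrite cReD cReN. Qed.
Let cImB (z y : C) : Im (z - y) = Im z - Im y. Proof. by rewrite cImD cImN. Qed.

Let g t : C := limn (fun j => Re (v j t)) +i* limn (fun j => Im (v j t)).

Let cvg_Re t : (fun j => Re (v j t)) @ \oo --> Re (g t).
Proof.
have h : cvgn (fun j => Re (v j t)).
  by apply: cvg_part; [exact: cReB|exact: Re_le_cabs|].
exact: h.
Qed.

Let cvg_Im t : (fun j => Im (v j t)) @ \oo --> Im (g t).
Proof.
have h : cvgn (fun j => Im (v j t)).
  by apply: cvg_part; [exact: cImB|exact: Im_le_cabs|].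
exact: h.
Qed.

Let cmeas_g : cmeas (fun x => g (e x)).
Proof.
split.
  apply: (@measurable_fun_cvg _ _ _ E (fun j x => Re (v j (e x)))).
    by move=> j; have [] := cmeas_v j.
  by move=> x _; exact: cvg_Re.
apply: (@measurable_fun_cvg _ _ _ E (fun j x => Im (v j (e x)))).
  by move=> j; have [] := cmeas_v j.
by move=> x _; exact: cvg_Im.
Qed.

(** The first term plus the total variation [S] dominates the whole sequence, and both are
    integrable. *)
Let v_dom j t : cabs (v j t) <= cabs (w 0%N t) + fine (S t).
Proof.
rewrite /v; case: ifP => gt; last by rewrite cabs0 addr_ge0 ?cabs_ge0 ?fine_ge0.
apply: le_trans (lerD (lexx _) (Pfine j gt)).
elim: j => [|j ih]; first by rewrite /P big_ord0 addr0.
rewrite /P big_ord_recr /= addrA -[w j.+1 t](subrK (w j t)) [X in cabs X]addrC.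
by rewrite (le_trans (cabsD _ _))// lerD// addrK.
Qed.

Let idom : intb (fun x => cabs (w 0%N (e x)) + fine (S (e x))).
Proof. by apply: intbD => //; apply: intb_cabs; exact: wi. Qed.

Let cint_v j : cint (fun x => v j (e x)).
Proof.
apply: cint_cabs => //; apply: intb_dom idom; first exact: measurable_cabs.
by move=> x _; rewrite ger0_norm ?cabs_ge0.
Qed.

Let cabs_cvg t : (fun j => cabs (v j t)) @ \oo --> cabs (g t).
Proof.
exact: (cvg_cabs (@cvg_Re t) (@cvg_Im t)).
Qed.

Let g_dom t : cabs (g t) <= cabs (w 0%N t) + fine (S t).
Proof.
rewrite -(cvg_lim _ (@cabs_cvg t))//; apply: limr_le.
  by apply/cvg_ex; eexists; exact: cabs_cvg.
by apply: nearW => j; exact: v_dom.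
Qed.

Let cint_g : L1 g.
Proof.
apply: cint_cabs => //; apply: intb_dom idom; first exact: measurable_cabs.
by move=> x _; rewrite ger0_norm ?cabs_ge0.
Qed.

Let v_cvg : tends0 (fun j => mean (fun x => cabs (v j (e x) - g (e x)))).
Proof.
have part (T : C -> R) : (forall z y, T (z - y) = T z - T y) ->
    (forall z, `|T z| <= cabs z) ->
    (forall t, (fun j => T (v j t)) @ \oo --> T (g t)) ->
    (forall j, measurable_fun E (fun x => T (v j (e x)))) ->
    measurable_fun E (fun x => T (g (e x))) ->
    tends0 (fun j => mean (fun x => `|T (v j (e x)) - T (g (e x))|)).
  move=> TB Tc Tv mv mg; apply: cvg_tends0; apply: dominated_mean idom _ => //.
    by apply: aeT_all => x _; exact: Tv.
  by move=> j x _; rewrite (le_trans (Tc _)).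
have t1 := part Re cReB (@Re_le_cabs R) cvg_Re (fun j => (cmeas_v j).1) cmeas_g.1.
have t2 := part Im cImB (@Im_le_cabs R) cvg_Im (fun j => (cmeas_v j).2) cmeas_g.2.
have := tends0D t1 t2; apply: tends0_le => j.
have di := cintB (cint_v j) cint_g; have [d1 d2] := di.
have e1 := intb_norm d1; have e2 := intb_norm d2.
have q1 : intb (fun x => `|Re (v j (e x)) - Re (g (e x))|).
  by apply: eq_intb e1 => x _; rewrite cReB.
have q2 : intb (fun x => `|Im (v j (e x)) - Im (g (e x))|).
  by apply: eq_intb e2 => x _; rewrite cImB.
rewrite -meanD//; apply: le_mean; [exact: intb_cabs|exact: intbD|].
by move=> x _; rewrite (le_trans (cabs_le_ReIm _))// cReB cImB.
Qed.

Let w_v j : aeT (fun x => w j (e x) = v j (e x)).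
Proof. by apply: aeT_imp ae_good => x _; rewrite /v => ->. Qed.

(** Fatou's lemma along [v]. With an integer exponent, convergence of the powers is repeated
    multiplication. *)
Let g_Lp (n : nat) (B : R) : let p := n%:R in (forall j, Lp p (w j)) ->
  (forall j, mean (fun x => cabs (w j (e x)) `^ p) <= B) -> Lp p g.
Proof.
move=> p wp wB; split => //.
have mv j : measurable_fun E (fun x => cabs (v j (e x)) `^ p).
  exact: measurable_cabs_powR.
have pc x : (fun j => (cabs (v j (e x)) `^ p)%:E) @ \oo --> (cabs (g (e x)) `^ p)%:E.
  apply: cvg_EFin; first exact: nearW.
  under eq_fun do rewrite powR_mulrn ?cabs_ge0//.
  rewrite powR_mulrn ?cabs_ge0//; elim: n {p wp wB mv} => [|n ih].
    by under eq_fun do rewrite expr0; rewrite expr0; exact: cvg_cst.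
  by under eq_fun do rewrite exprS; rewrite exprS; apply: cvgM => //; exact: cabs_cvg.
apply: (@le_lt_trans _ _ (pi *+ 2 * B)%:E); last exact: ltry.
have -> : lpint p g = (\int[mu]_(x in E) limn_einf (fun j => (cabs (v j (e x)) `^ p)%:E))%E.
  apply: eq_integral => x _; by rewrite (cvg_limn_einf_sup (@pc x)).1.
have mv' j : measurable_fun E (fun x => (cabs (v j (e x)) `^ p)%:E).
  by apply/measurable_EFinP; exact: mv.
have v0 j x : E x -> (0 <= (cabs (v j (e x)) `^ p)%:E)%E.
  by move=> _; rewrite lee_fin powR_ge0.
apply: le_trans (@fatou _ _ _ mu E (@measurable_Tdom R) _ mv' v0) _.
rewrite limn_einf_lim; apply: lime_le; first exact: is_cvg_einfs.
apply: nearW => j; apply: (@le_trans _ _ (\int[mu]_(x in E) (cabs (v j (e x)) `^ p)%:E)%E).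
  by apply: ereal_inf_lbound; exists j => //=.
have [mw iw] := (Lp_intbP p _).1 (wp j).
have vw : aeT (fun x => `|cabs (v j (e x)) `^ p| <= cabs (w j (e x)) `^ p).
  by apply: aeT_imp (w_v j) => x _ ->; rewrite ger0_norm ?powR_ge0.
rewrite integral_mean; last exact: ae_intb_dom vw iw.
rewrite lee_fin ler_wpM2l ?(ltW (pi2_gt0 R))//.
apply: le_trans (wB j); rewrite (@ae_mean _ _ (fun x => cabs (w j (e x)) `^ p))//.
  exact: measurable_cabs_powR.
by apply: aeT_imp (w_v j) => x _ ->.
Qed.

(** Completeness of L^1 along a fast Cauchy sequence; the same limit inherits every uniform bound on
    the means of integer powers. *)
Lemma L1_fast_limit : exists g : C -> C, [/\ L1 g,
  tends0 (fun j => mean (fun x => cabs (w j (e x) - g (e x)))) &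
  forall (n : nat) (B : R), (forall j, Lp n%:R (w j)) ->
    (forall j, mean (fun x => cabs (w j (e x)) `^ n%:R) <= B) -> Lp n%:R g].
Proof.
exists g; split; [exact: cint_g| |by move=> n B h1 h2; exact: (g_Lp h1 h2)].
apply: tends0_le v_cvg => j.
rewrite (@ae_mean _ _ (fun x => cabs (v j (e x) - g (e x))))//.
- apply: measurable_cabs; apply: cmeasB => //; exact/cint_cmeas/wi.
- by apply: measurable_cabs; apply: cmeasB.
- by apply: aeT_imp (w_v j) => x _ ->.
Qed.

End FastLimit.

(** * The projection of a bounded function *)

Section RieszBounded.
Local Open Scope classical_set_scope.
Local Open Scope ring_scope.
Local Open Scope complex_scope.
Variable R : realType.
Local Notation C := R[i].
Local Notation Re := (@complex.Re R).
Local Notation Im := (@complex.Im R).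
Local Notation E := (@Tdom R).
Local Notation e := (@circ_pt R).
Implicit Types (f g : C -> C) (p : R) (q : {poly C}).

Lemma tends0_eq0 (z : C) (b : nat -> R) : (forall n, cabs z <= b n) -> tends0 b -> z = 0.
Proof.
move=> zb tb; apply: cabs_eq0; apply/eqP; rewrite eq_le cabs_ge0 andbT leNgt.
apply/negP => /tb[N /(_ N (leqnn N))]; by rewrite ltNge zb.
Qed.

Lemma tends0_subseq (b : nat -> R) (k : nat -> nat) : (forall j, (j <= k j)%N) ->
  tends0 b -> tends0 (fun j => b (k j)).
Proof.
move=> kj tb eps e0; have [N h] := tb eps e0; exists N => n Nn.
by apply: h; exact: leq_trans (kj n).
Qed.

Lemma Lp_horner (n : nat) q : Lp n%:R (fun t => q.[t]).
Proof.
apply/Lp_intbP; split; first by apply: cint_cmeas; exact: cint_horner.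
apply: eq_intb (intb_cabs (cint_horner (q ^+ n))) => x _.
by rewrite powR_mulrn ?cabs_ge0// horner_exp cabsX.
Qed.

Lemma Lp_weaken p r f : 0 <= p <= r -> Lp r f -> Lp p f.
Proof.
move=> /andP[p0 pr] /Lp_intbP[mf fi]; apply/Lp_intbP; split; first exact: mf.
apply: (intb_dom _ _ (intbD (intb_cst 1) fi)); first exact: measurable_cabs_powR.
move=> x _; rewrite ger0_norm ?powR_ge0//.
have [h|h] := leP (cabs (f (e x))) 1.
  rewrite (@le_trans _ _ 1) ?lerDl ?powR_ge0//.
  have -> : 1 = 1 `^ p :> R by rewrite powR1.
  by apply: ge0_ler_powR; rewrite ?nnegrE ?cabs_ge0.
by rewrite (@le_trans _ _ (cabs (f (e x)) `^ r)) ?lerDr// ler_powR// ltW.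
Qed.

(** * Projection of a bounded real function *)

Section RealSymbol.
Variables (a : C -> C) (M : R).
Hypothesis ma : cmeas (fun x => a (e x)).
Hypothesis a_real : forall x, Im (a (e x)) = 0.
Hypothesis aM : forall x, `|Re (a (e x))| <= M.

Let M0 : 0 <= M. Proof. by rewrite (le_trans _ (aM 0)). Qed.

Let ar x := Re (a (e x)).
Let mar : measurable_fun E ar. Proof. by case: ma. Qed.
Let iar : intb ar.
Proof. by apply: (intb_bounded (c := M)) => // x _; exact: aM. Qed.

Let ai : L1 a.
Proof. by split => //; apply: eq_intb (intb_cst 0) => x _; exact/esym/a_real. Qed.

Let W N := conj_poly a N.+1.

Let ReW N x : Re (W N).[e x] = sigma N.+1 ar x.
Proof. exact: Re_conj_poly. Qed.

Let intb_sqr (u : R -> R) (c : R) : measurable_fun E u -> (forall x, E x -> `|u x| <= c) ->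
  intb (fun x => u x ^+ 2).
Proof.
move=> mu_ uc; apply: (@intb_bounded _ _ (c ^+ 2)); first exact: measurable_funX.
move=> x Ex; rewrite normrX; apply: lerXn2r; rewrite ?nnegrE ?uc//.
exact: le_trans (uc x Ex).
Qed.

Let dist2 N := mean (fun x => (sigma N.+1 ar x - ar x) ^+ 2).

Let idist2 N : intb (fun x => (sigma N.+1 ar x - ar x) ^+ 2).
Proof.
apply: (@intb_sqr _ (M + M)).
  by apply: intb_measurable; apply: intbB => //; exact: intb_sigma.
move=> x Ex; rewrite (le_trans (ler_normB _ _))// lerD ?aM//.
by apply: sigma_bounded => // y _; exact: aM.
Qed.

Let dist2_tends0 : tends0 dist2.
Proof.
have := @sigma_Lp_bounded _ ar 2 M _ mar (fun y _ => aM y).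
move=> /(_ ltac:(by rewrite ler1n)); apply: tends0_le => N.
rewrite le_eqVlt; apply/orP; left; apply/eqP; apply: eq_mean => x _.
by rewrite -[2 in RHS]/(2%:R) powR_mulrn// real_normK ?num_real.
Qed.

(** The inequality s <= d/2 + (2/d) s^2 passes from L^2 to L^1 in place of Cauchy-Schwarz. The
    difference q vanishes at 0, so the mean of |q|^2 is twice that of the square of Re q, which is
    at most twice the sum of the two distances: 2/d times 2 times 2 is 8/d. *)
Let W_cauchy N N' (d : R) : 0 < d ->
  mean (fun x => cabs ((W N).[e x] - (W N').[e x])) <=
  d / 2 + 8 / d * (dist2 N + dist2 N').
Proof.
move=> d0; pose q := W N - W N'.
have q0 : q.[0] = 0 by rewrite hornerD hornerN !conj_poly0// subrr.
have qE x : q.[e x] = (W N).[e x] - (W N').[e x] by rewrite hornerD hornerN.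
have Rq x : Re q.[e x] = sigma N.+1 ar x - sigma N'.+1 ar x.
  by rewrite qE cReD cReN !ReW.
have is1 K : intb (sigma K ar) by exact: intb_sigma.
have iRe : intb (fun x => Re q.[e x] ^+ 2).
  apply: (@intb_sqr _ (M + M)).
    by have [] := cint_cmeas (cint_horner q).
  move=> x Ex; rewrite Rq (le_trans (ler_normB _ _))// lerD//;
  by apply: sigma_bounded => // y _; exact: aM.
have icab : intb (fun x => cabs q.[e x] ^+ 2).
  apply: eq_intb (intb_cabs (cint_horner (q ^+ 2))) => x _.
  by rewrite horner_exp cabsX.
have iIm : intb (fun x => Im q.[e x] ^+ 2).
  apply: eq_intb (intbB icab iRe) => x _; rewrite sqr_cabs; ring.
have mRe : mean (fun x => Re q.[e x] ^+ 2) <= 2 * (dist2 N + dist2 N').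
  rewrite -meanD// -meanZ; last exact: intbD.
  apply: le_mean => //; first by apply: intbZ; exact: intbD.
  move=> x _; rewrite Rq; set s := sigma N.+1 ar x; set t := sigma N'.+1 ar x.
  by have := sqr_ge0 ((s - ar x) + (t - ar x)); lra.
apply: (@le_trans _ _ (mean (fun x => d / 2 + 2 / d * cabs q.[e x] ^+ 2))).
  apply: le_mean; first by apply: intb_cabs; apply: cintB; exact: cint_horner.
    by apply: intbD; [exact: intb_cst|exact: intbZ].
  move=> x _; rewrite -qE; set s := cabs _.
  have s0 : 0 <= s by exact: cabs_ge0.
  have [sd|sd] := leP s (d / 2).
    by rewrite (le_trans sd)// lerDl mulr_ge0 ?sqr_ge0// divr_ge0// ltW.
  rewrite (@le_trans _ _ (2 / d * s ^+ 2))//; last by rewrite lerDr divr_ge0// ltW.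
  rewrite expr2 mulrA ler_peMl// mulrAC ler_pdivlMr// mul1r.
  by rewrite ltW// -ltr_pdivrMl// mulrC.
rewrite meanD; [|exact: intb_cst|exact: intbZ].
rewrite mean_cst lerD2l meanZ//.
have -> : mean (fun x => cabs q.[e x] ^+ 2) = 2 * mean (fun x => Re q.[e x] ^+ 2).
  rewrite (eq_mean (g := fun x => Re q.[e x] ^+ 2 + Im q.[e x] ^+ 2)); last first.
    by move=> x _; rewrite sqr_cabs.
  by rewrite meanD// mean_sqr_Im// mulrDl mul1r.
have i0 : 0 <= d^-1 by rewrite invr_ge0 ltW.
rewrite -!mulrA mulrCA [leRHS]mulrCA ler_wpM2l//.
rewrite mulrA -natrM (_ : 8 = 4 * 2 :> R); last by rewrite -natrM.
by rewrite -mulrA ler_wpM2l.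
Qed.

Let subseq : exists k : nat -> nat, (forall j, (j <= k j)%N) /\
  forall j, mean (fun x => cabs ((W (k j.+1)).[e x] - (W (k j)).[e x])) <= 2 ^- j.
Proof.
(* With d = 2^-j, two distances below d^2/32 make 8/d times their sum at most d/2, so [W_cauchy]
   gives d. *)
have h j : exists N0, forall n, (N0 <= n)%N -> dist2 n < (2 ^- j) ^+ 2 / 32.
  by apply: dist2_tends0; rewrite divr_gt0// exprn_gt0// invr_gt0 exprn_gt0.
have [N0 hN0] := choice h.
(* Summing successors makes k strictly increasing while keeping k j >= N0 j. *)
pose k j := (\sum_(i < j.+1) (N0 i).+1)%N.
have kN j : (N0 j <= k j)%N.
  by rewrite /k big_ord_recr /=; apply: leq_trans (leq_addl _ _); exact: leqnSn.
have kS j : (k j < k j.+1)%N.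
  by rewrite {2}/k big_ord_recr /= -/(k j) addnS ltnS leq_addr.
exists k; split.
  by elim=> [//|j ih]; exact: leq_ltn_trans ih (kS j).
move=> j; set d : R := 2 ^- j; have d0 : 0 < d by rewrite invr_gt0 exprn_gt0.
apply: le_trans (W_cauchy _ _ d0) _.
have h1 := hN0 j (k j) (kN j).
have h2 := hN0 j (k j.+1) (leq_trans (kN j) (ltnW (kS j))).
rewrite -/d in h1 h2.
have : 8 / d * (dist2 (k j.+1) + dist2 (k j)) <= 8 / d * (d ^+ 2 / 32 + d ^+ 2 / 32).
  apply: ler_wpM2l; last exact: (lerD (ltW h2) (ltW h1)).
  exact: (divr_ge0 (ler0n _ 8) (ltW d0)).
have -> : 8 / d * (d ^+ 2 / 32 + d ^+ 2 / 32) = d / 2 by field; rewrite gt_eqF.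
by move=> h3; rewrite [leRHS](splitr d) lerD2l; exact: h3.
Qed.

(** Along the subsequence the polynomials [W] converge in L^1 to some g whose coefficients are 2 a_n
    for n > 0, a_0 at 0 and zero below; the projection is (g + a_0)/2. *)
Lemma riesz_real p : 0 <= p -> exists g, is_P p a g.
Proof.
move=> p0; have [k [kj kd]] := subseq.
pose w j t := (W (k j)).[t].
have wi j : L1 (w j) by exact: cint_horner.
have [g [gi gw gLp]] := L1_fast_limit wi kd.
have fcvg : tends0 (fun j => 2 * mean (fun x => cabs (w j (e x) - g (e x)))).
  exact: tends0Z.
have fw n j : cabs (fourier (w j) n - fourier g n) <=
    2 * mean (fun x => cabs (w j (e x) - g (e x))).
  by rewrite -fourierB//; apply: (@cabs_fourier _ (fun t => w j t - g t)); exact: (cintB (wi j) gi).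
have gneg n : n < 0 -> fourier g n = 0.
  move=> n0; apply: (tends0_eq0 _ fcvg) => j.
  apply: le_trans (fw n j); rewrite fourier_horner.
  by case: n n0 => // n _; rewrite sub0r cabsN.
have gpos (n : nat) : fourier g n = 2 * fourier a n - fourier a 0 *+ (n == 0%N).
  apply/eqP; rewrite eq_sym -subr_eq0; apply/eqP.
  have t1 := tends0_subseq kj (fejer_L1 ai).
  (* The constant 4 is the factor 2 before the Fejer coefficient times the factor 2 of
     [cabs_fourier]. *)
  have t2 := tends0D fcvg (tends0Z (ler0n R 4) t1).
  apply: (tends0_eq0 _ t2) => j /=.
  have fj : L1 (fejer (k j).+1 a).
    by apply: eq_cint (cint_cfejer (k j).+1 (fun y => a (e y))) => x _; rewrite fejer_cfejer.
  have -> : 2 * fourier a n - fourier a 0 *+ (n == 0%N) - fourier g n =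
     (fourier (w j) n - fourier g n) - 2 * (fourier (fejer (k j).+1 a) n - fourier a n).
    by rewrite /w fourier_conj_poly//; ring.
  rewrite (le_trans (cabsB _ _))// lerD// cabsM.
  have -> : cabs (2 : C) = 2.
    by rewrite (_ : (2 : C) = (2 : R)%:C) ?cabsR ?ger0_norm// rmorph_nat.
  rewrite (_ : 4 = 2 * 2 :> R); last by ring.
  rewrite -mulrA ler_wpM2l// -fourierB//.
  by apply: (@cabs_fourier _ (fun t => fejer (k j).+1 a t - a t)); exact: (cintB fj ai).
have gp : Lp p g.
  (* An even integer above p: [mean_Im_power] treats even exponents, and [Lp_weaken] descends to
     p. *)
  pose m := (2 * (Num.truncn p).+1)%N.
  have pm : 0 <= p <= m%:R.
    rewrite p0 /= (@le_trans _ _ (Num.truncn p).+1%:R)//; first by rewrite ltW// truncnS_gt.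
    by rewrite ler_nat /m mul2n -addnn leq_addr.
  apply: (Lp_weaken pm).
  have [B hB] := @mean_Im_power R M (Num.truncn p) M0 (cabs (fourier a 0)).
  apply: (gLp m (2 `^ m%:R * (M `^ m%:R + B))); first by move=> j; exact: Lp_horner.
  move=> j; have W0 : cabs (W (k j)).[0] <= cabs (fourier a 0) by rewrite conj_poly0.
  have WM x : `|Re (W (k j)).[e x]| <= M.
    by rewrite ReW; apply: sigma_bounded => // y _; exact: aM.
  have [ii im] := hB _ W0 WM.
  have [_ wpi] := (Lp_intbP m%:R _).1 (Lp_horner m (W (k j))).
  apply: (@le_trans _ _ (mean (fun x => 2 `^ m%:R * (M `^ m%:R + Im (W (k j)).[e x] ^+ m)))).
    apply: le_mean => //.
      by apply: intbZ; apply: intbD => //; exact: intb_cst.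
    move=> x _; have Im0 : 0 <= `|Im (W (k j)).[e x]| by [].
    have -> : Im (W (k j)).[e x] ^+ m = `|Im (W (k j)).[e x]| `^ m%:R.
      by rewrite powR_mulrn// /m !exprM real_normK ?num_real.
    apply: le_trans (powRD_le (ler0n R m) M0 Im0).
    apply: ge0_ler_powR; rewrite ?nnegrE ?cabs_ge0 ?addr_ge0//.
    by apply: (le_trans (cabs_le_ReIm _)); rewrite lerD2r; exact: WM.
  rewrite meanZ; last by apply: intbD => //; exact: intb_cst.
  rewrite meanD//; last exact: intb_cst.
  by rewrite mean_cst ler_wpM2l ?powR_ge0// lerD2l.
pose h t := 2^-1 * (g t + fourier a 0).
have ci : L1 (fun=> fourier a 0) by exact: cint_cst.
have hE n : fourier h n = 2^-1 * (fourier g n + fourier a 0 *+ (n == 0)).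
  rewrite fourierZ; last exact: (cintD gi ci).
  rewrite fourierD//; congr (_ * (_ + _)).
  rewrite (@eq_fourier _ _ (fun t => fourier a 0 * t ^ 0)); last by move=> x; rewrite expr0z mulr1.
  rewrite fourierZ; last exact: cint_circ.
  by rewrite fourier_mono; case: (n == 0); rewrite ?mulr1 ?mulr0.
exists h; split; [split|].
- exact: (LpZ _ p0 (LpD p0 gp (@Lp_cst _ p _))).
- move=> n n0; rewrite hE gneg// (lt_eqF n0) addr0 mulr0//.
- by case=> // n _; rewrite hE gpos eqz_nat subrK mulrA mulVf ?mul1r.
Qed.

End RealSymbol.

Lemma riesz_Linf p (a : C -> C) : 1 <= p -> Linf a -> exists g, is_P p a g.
Proof.
move=> p1 ai; have p0 : 0 <= p by rewrite (le_trans _ p1).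
have [[m1 m2] [M aM]] := ai.
have M0 : 0 <= `|M| by [].
have part (T : C -> R) : (forall z, `|T z| <= cabs z) ->
    measurable_fun E (fun x => T (a (e x))) ->
    exists g, is_P p (fun t => (T (a t))%:C) g.
  move=> Tc mT.
  (* The essential bound holds off a null set. Cutting off at |M| makes it hold everywhere, as
     [riesz_real] asks, and changes no Fourier coefficient. *)
  pose b t : C := (if `|T (a t)| <= `|M| then T (a t) else 0)%:C.
  have mb : cmeas (fun x => b (e x)).
    split; last exact: measurable_cst.
    have mc : measurable_fun E (fun x => `|T (a (e x))| <= `|M|).
      by apply: (@measurable_fun_ler _ _ _ E (fun x => `|T (a (e x))|) (fun=> `|M|)) => //;
        exact: measurableT_comp.
    apply: (measurable_fun_if _ mc) => //; first exact: measurable_Tdom.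
    by apply: (measurable_funS (@measurable_Tdom R) _ mT); exact: subIsetl.
  have bM x : `|Re (b (e x))| <= `|M|.
    by rewrite /b /=; case: ifP => //; rewrite normr0.
  have [g [gp gf]] := riesz_real mb (fun x => erefl) bM p0.
  exists g; split => // n n0; rewrite gf//; apply: ae_fourier; first exact: mb.
    by split; [exact: mT|exact: measurable_cst].
  apply: aeT_imp aM => x _ h; rewrite /b.
  by rewrite (le_trans (Tc _))// (le_trans h)// ler_norm.
have [g1 [[g1p g1n] g1f]] := part Re (@Re_le_cabs R) m1.
have [g2 [[g2p g2n] g2f]] := part Im (@Im_le_cabs R) m2.
have i1 := Lp_L1 p1 g1p; have i2 := Lp_L1 p1 g2p.
have i2' : L1 (fun t => 'i * g2 t) by exact: cintZ.
have aL := Lp_L1 p1 (Linf_Lp p0 ai).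
have [a1 a2] := aL.
have aE n : fourier a n = fourier (fun t => (Re (a t))%:C) n +
    'i * fourier (fun t => (Im (a t))%:C) n.
  have h1 : L1 (fun t => (Re (a t))%:C) by exact: cint_real.
  have h2 : L1 (fun t => (Im (a t))%:C) by exact: cint_real.
  have h2' : L1 (fun t => 'i * (Im (a t))%:C) by exact: cintZ.
  rewrite -fourierZ// -fourierD//; apply: eq_fourier => x.
  by rewrite -complexE.
exists (fun t => g1 t + 'i * g2 t); split; [split|].
- exact: (LpD p0 g1p (LpZ _ p0 g2p)).
- by move=> n n0; rewrite fourierD// fourierZ// g1n// g2n// mulr0 addr0.
- by move=> n n0; rewrite fourierD// fourierZ// g1f// g2f// aE.
Qed.

End RieszBounded.

(** * Toeplitz plus Hankel operators *)

Section ToeplitzHankel.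
Local Open Scope classical_set_scope.
Local Open Scope ring_scope.
Local Open Scope complex_scope.
Variable R : realType.
Local Notation C := R[i].
Local Notation e := (@circ_pt R).
Implicit Types (f g h u v : C -> C).

Lemma eq_cmeasurable f g : (forall x, f (e x) = g (e x)) ->
  cmeasurable f -> cmeasurable g.
Proof.
move=> fg [m1 m2]; split.
  by under eq_fun do rewrite -fg; exact: m1.
by under eq_fun do rewrite -fg; exact: m2.
Qed.

Lemma eq_Lp p f g : (forall x, f (e x) = g (e x)) -> Lp p f -> Lp p g.
Proof.
move=> fg [mf fy]; split; first exact: eq_cmeasurable fg mf.
rewrite /lpint; under eq_integral do rewrite -fg.
exact: fy.
Qed.

(** * Functions whose projection exists: sums, multiples, shifts *)

Section Projection.
Variable p : R.
Hypothesis p1 : 1 < p.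

Let p0 : 0 <= p. Proof. by rewrite ltW// (lt_trans _ p1). Qed.
Let L1p f : Lp p f -> L1 f. Proof. exact: (Lp_L1 (ltW p1)). Qed.

(** Existence is a property carried along: for unbounded functions it is obtained only from the
    kernel element and from closure under sums, multiples and shifts. *)
Definition has_P u : Prop := exists g, is_P p u g.

Lemma eq_has_P u v : (forall n : int, 0 <= n -> fourier u n = fourier v n) ->
  has_P u -> has_P v.
Proof. by move=> uv [g [gH gu]]; exists g; split => // n n0; rewrite gu// uv. Qed.

Lemma HpD f g : Hp p f -> Hp p g -> Hp p (fun t => f t + g t).
Proof.
move=> [fp fn] [gp gn]; split; first exact: (LpD p0 fp gp).
by move=> n n0; rewrite fourierD; [rewrite fn// gn// addr0|exact: L1p|exact: L1p].
Qed.

Lemma HpZ c f : Hp p f -> Hp p (fun t => c * f t).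
Proof.
move=> [fp fn]; split; first exact: (LpZ _ p0 fp).
by move=> n n0; rewrite fourierZ; [rewrite fn// mulr0|exact: L1p].
Qed.

Lemma has_PD u v : Lp p u -> Lp p v -> has_P u -> has_P v -> has_P (fun t => u t + v t).
Proof.
move=> up vp [g [gH gu]] [h [hH hv]]; exists (fun t => g t + h t); split.
  exact: HpD.
have [gp _] := gH; have [hp _] := hH.
move=> n n0; rewrite fourierD; [|exact: L1p|exact: L1p].
by rewrite fourierD; [rewrite gu// hv|exact: L1p|exact: L1p].
Qed.

Lemma has_PZ c u : Lp p u -> has_P u -> has_P (fun t => c * u t).
Proof.
move=> up [g [gH gu]]; exists (fun t => c * g t); split; first exact: HpZ.
have [gp _] := gH; move=> n n0.
by rewrite fourierZ; [rewrite fourierZ; [rewrite gu|exact: L1p]|exact: L1p].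
Qed.

Lemma fourier_cst (c : C) n : fourier (fun=> c) n = c *+ (n == 0).
Proof.
rewrite (@eq_fourier _ _ (fun t => c * t ^ 0)); last by move=> x; rewrite expr0z mulr1.
rewrite fourierZ; last exact: cint_circ.
by rewrite fourier_mono; case: (n == 0); rewrite ?mulr1 ?mulr0.
Qed.

(** P(t u) = t P u + u_(-1): one coefficient enters from the negative side. *)
Lemma has_P_shift1 u : has_P u -> has_P (fun t => t ^ 1 * u t).
Proof.
move=> [g [[gp gn] gu]].
have tg := Lp_shift 1 p0 gp; have cc := @Lp_cst _ p (fourier u (-1)).
have E n : fourier (fun t => t ^ 1 * g t + fourier u (-1)) n =
    fourier g (n - 1) + fourier u (-1) *+ (n == 0).
  by rewrite fourierD; [rewrite fourier_shift fourier_cst|exact: L1p|exact: L1p].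
exists (fun t => t ^ 1 * g t + fourier u (-1)); split; [split|].
- exact: (LpD p0 tg cc).
- move=> n n0; rewrite E (lt_eqF n0) addr0 gn//.
  by rewrite (lt_trans _ n0)// gtrBl.
- move=> n n0; rewrite E fourier_shift.
  have [->|nn0] := eqVneq n 0; first by rewrite sub0r gn// add0r.
  rewrite addr0 gu//.
  by rewrite subr_ge0 -gtz0_ge1 lt_neqAle eq_sym nn0.
Qed.

(** P(t^-1 u) = t^-1 (P u - u_0): one coefficient leaves to the negative side. *)
Lemma has_P_shiftN1 u : has_P u -> has_P (fun t => t ^ (-1) * u t).
Proof.
move=> [g [[gp gn] gu]].
have cc := @Lp_cst _ p (- fourier g 0); have gc := LpD p0 gp cc.
have E n : fourier (fun t => t ^ (-1) * (g t + - fourier g 0)) n =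
    fourier g (n + 1) - fourier g 0 *+ (n + 1 == 0).
  rewrite (fourier_shift (fun t => g t + - fourier g 0)) opprK fourierD; [|exact: L1p|exact: L1p].
  by rewrite fourier_cst mulNrn.
exists (fun t => t ^ (-1) * (g t + - fourier g 0)); split; [split|].
- exact: (Lp_shift (-1) p0 gc).
- move=> n n0; rewrite E; have [->|nn] := eqVneq (n + 1) 0; first by rewrite subrr.
  by rewrite subr0 gn// lt_neqAle nn lezD1.
- move=> n n0; rewrite E fourier_shift opprK.
  have n1 : 0 < n + 1 by rewrite ltzD1.
  by rewrite (gt_eqF n1) subr0 gu// ltW.
Qed.

End Projection.

Lemma Lp_Jop p f : 0 <= p -> Lp p f -> Lp p (Jop f).
Proof.
move=> p0 fp; apply: eq_Lp (Lp_shift (-1) p0 (Lp_reversal fp)) => x.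
by rewrite /Jop exprN1.
Qed.

Lemma fourier_Jop f n : L1 f -> fourier (Jop f) n = fourier f (- (n + 1)).
Proof.
move=> fi; rewrite -fourier_reversal// -[X in fourier _ X](opprK) .
rewrite (@eq_fourier _ _ (fun t => t ^ (-1) * f t^-1)); last first.
  by move=> x; rewrite /Jop exprN1.
by rewrite fourier_shift !opprK.
Qed.

(** * The four operators in the common form b = a t^k *)

Section Operator.
Variables (p : R) (a : C -> C) (s : C) (k : int).
Hypothesis p1 : 1 < p.
Hypothesis aG : GLinf a.
Hypothesis ks : [\/ k = 1 /\ s = 1, k = -1 /\ s = -1, k = 0 /\ s = 1 | k = 0 /\ s = -1].
Let b t : C := a t * t ^ k.

Let p0 : 0 <= p. Proof. by rewrite ltW// (lt_trans _ p1). Qed.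
Let L1p f : Lp p f -> L1 f. Proof. exact: (Lp_L1 (ltW p1)). Qed.
Let aI : Linf a. Proof. by case: aG. Qed.
Let bI : Linf b. Proof. exact: Linf_mono_mul. Qed.
Let Lpa f : Lp p f -> Lp p (fun t => a t * f t). Proof. exact: (Lp_mul_inf p0 aI). Qed.
Let LpbJ f : Lp p f -> Lp p (fun t => b t * Jop f t).
Proof. by move=> fp; exact: (Lp_mul_inf p0 bI (Lp_Jop p0 fp)). Qed.

(** Coefficients of a f + s b J f before projection, negative indices included; from index 0 on they
    are those of A f. *)
Let coef f n : C :=
  fourier (fun t => a t * f t) n + s * fourier (fun t => b t * Jop f t) n.

(** Membership in H^p is left out on purpose: [kappa] and, in general, t^-1 f have a coefficient at
    -1. *)
Let Dom f : Prop := [/\ Lp p f, has_P p (fun t => a t * f t) &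
  has_P p (fun t => b t * Jop f t)].

Let DomD f g : Dom f -> Dom g -> Dom (fun t => f t + g t).
Proof.
move=> [fp f1 f2] [gp g1 g2]; split; first exact: (LpD p0 fp gp).
  apply: eq_has_P (has_PD p1 (Lpa fp) (Lpa gp) f1 g1) => n _.
  by apply: eq_fourier => x; rewrite mulrDr.
apply: eq_has_P (has_PD p1 (LpbJ fp) (LpbJ gp) f2 g2) => n _.
by apply: eq_fourier => x; rewrite /Jop !mulrDr.
Qed.

Let DomZ c f : Dom f -> Dom (fun t => c * f t).
Proof.
move=> [fp f1 f2]; split; first exact: (LpZ _ p0 fp).
  apply: eq_has_P (has_PZ p1 c (Lpa fp) f1) => n _.
  by apply: eq_fourier => x; rewrite mulrCA.
apply: eq_has_P (has_PZ p1 c (LpbJ fp) f2) => n _.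
by apply: eq_fourier => x; rewrite /Jop mulrCA; congr (_ * _); rewrite mulrCA.
Qed.

Let Jop_shift f (j : int) x :
  Jop (fun t => t ^ j * f t) (e x) = e x ^ (- j) * Jop f (e x).
Proof. by rewrite /Jop exprz_inv mulrCA. Qed.

Let Dom_shift1 f : Dom f -> Dom (fun t => t ^ 1 * f t).
Proof.
move=> [fp f1 f2]; split; first exact: (Lp_shift _ p0 fp).
  apply: eq_has_P (has_P_shift1 p1 f1) => n _.
  by apply: eq_fourier => x; rewrite mulrCA.
apply: eq_has_P (has_P_shiftN1 p1 f2) => n _.
by apply: eq_fourier => x; rewrite Jop_shift [in RHS]mulrCA.
Qed.

Let Dom_shiftN1 f : Dom f -> Dom (fun t => t ^ (-1) * f t).
Proof.
move=> [fp f1 f2]; split; first exact: (Lp_shift _ p0 fp).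
  apply: eq_has_P (has_P_shiftN1 p1 f1) => n _.
  by apply: eq_fourier => x; rewrite mulrCA.
apply: eq_has_P (has_P_shift1 p1 f2) => n _.
by apply: eq_fourier => x; rewrite Jop_shift opprK [in RHS]mulrCA.
Qed.

(** The entry point of [riesz_Linf]: since J 1 = t^-1, the functions to project are a and b t^-1,
    both bounded. The monomials in [kappa] then follow by shifts. *)
Let Dom1 : Dom (fun=> 1).
Proof.
split; first exact: Lp_cst.
  have [g gP] := riesz_Linf (ltW p1) aI.
  apply: (@eq_has_P p a); last by exists g.
  by move=> n _; apply: eq_fourier => x; rewrite mulr1.
have [g gP] := riesz_Linf (ltW p1) (Linf_mono_mul (-1) bI).
apply: (@eq_has_P p (fun t => b t * t ^ (-1))); last by exists g.
by move=> n _; apply: eq_fourier => x; rewrite /Jop mulr1 exprN1.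
Qed.

Let coefD f g n : Lp p f -> Lp p g -> coef (fun t => f t + g t) n = coef f n + coef g n.
Proof.
move=> fp gp; rewrite /coef.
rewrite (@eq_fourier _ _ (fun t => a t * f t + a t * g t)); last by move=> x; rewrite mulrDr.
rewrite (@eq_fourier _ (fun t => b t * Jop (fun t => f t + g t) t)
  (fun t => b t * Jop f t + b t * Jop g t)); last by move=> x; rewrite /Jop !mulrDr.
rewrite fourierD; [|exact: (L1p (Lpa fp))|exact: (L1p (Lpa gp))].
rewrite fourierD; [|exact: (L1p (LpbJ fp))|exact: (L1p (LpbJ gp))].
by rewrite mulrDr addrACA.
Qed.

Let coefZ c f n : Lp p f -> coef (fun t => c * f t) n = c * coef f n.
Proof.
move=> fp; rewrite /coef.
rewrite (@eq_fourier _ _ (fun t => c * (a t * f t))); last by move=> x; rewrite mulrCA.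
rewrite (@eq_fourier _ (fun t => b t * Jop (fun t => c * f t) t)
  (fun t => c * (b t * Jop f t))); last first.
  by move=> x; rewrite /Jop [RHS]mulrCA; congr (_ * _); rewrite mulrCA.
rewrite fourierZ; last exact: (L1p (Lpa fp)).
rewrite fourierZ; last exact: (L1p (LpbJ fp)).
by rewrite [RHS]mulrDr; congr (_ + _); rewrite mulrCA.
Qed.

(** J reverses a shift, so the two summands move in opposite directions. Adding the cases j = 1 and
    j = -1 restores an expression in [coef] alone. *)
Let coef_shift f (j n : int) : coef (fun t => t ^ j * f t) n =
  fourier (fun t => a t * f t) (n - j) + s * fourier (fun t => b t * Jop f t) (n + j).
Proof.
rewrite /coef (@eq_fourier _ _ (fun t => t ^ j * (a t * f t))); last by move=> x; rewrite mulrCA.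
rewrite (@eq_fourier _ (fun t => b t * Jop (fun t => t ^ j * f t) t)
  (fun t => t ^ (- j) * (b t * Jop f t))); last by move=> x; rewrite Jop_shift [in RHS]mulrCA.
by rewrite !fourier_shift opprK.
Qed.

Let sym f t : C := f t + s * t ^ k * Jop f t.

Let Lp_sym f : Lp p f -> Lp p (sym f).
Proof.
move=> fp; have h := LpZ s p0 (Lp_shift k p0 (Lp_Jop p0 fp)).
by apply: eq_Lp (LpD p0 fp h) => x; rewrite /sym mulrA.
Qed.

Let coefE f n : Lp p f -> coef f n = fourier (fun t => a t * sym f t) n.
Proof.
move=> fp; rewrite /coef -fourierZ; last exact: (L1p (LpbJ fp)).
rewrite -fourierD; [|exact: (L1p (Lpa fp))|exact: (L1p (LpZ s p0 (LpbJ fp)))].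
apply: eq_fourier => x; rewrite /sym mulrDr; congr (_ + _).
by rewrite /b; ring.
Qed.

(** Each witness is fixed by the involution f -> - s t^k J f. As J t^-1 = 1, this map sends - t^-1
    to s t^k: adding the image gives - t^-1 + t for k = 1 and - t^-1 + s for k = 0, while for k = -1
    and s = -1 the function - t^-1 is already fixed. *)
Let kappa : exists h, [/\ Dom h, forall n, coef h n = 0,
  forall n : int, n < -1 -> fourier h n = 0 & fourier h (-1) = -1].
Proof.
have Dm : Dom (fun t => (-1) * (t ^ (-1) * 1)) by exact/DomZ/Dom_shiftN1.
have Dp : Dom (fun t => s * (t ^ 1 * 1)) by exact/DomZ/Dom_shift1.
have Dc : Dom (fun t => s * 1) by exact: DomZ.
have build h : Dom h -> (forall x, sym h (e x) = 0) -> forall n, coef h n = 0.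
  move=> [hp _ _] h0 n; rewrite coefE//.
  rewrite (@eq_fourier _ _ (fun=> 0)); last by move=> x; rewrite h0 mulr0.
  by rewrite fourier_cst mul0rn.
have fm (c : C) (j n : int) : fourier (fun t => c * (t ^ j * 1)) n = c *+ (n == j).
  rewrite (@eq_fourier _ _ (fun t => c * t ^ j)); last by move=> x; rewrite mulr1.
  rewrite fourierZ; last exact: cint_circ.
  by rewrite fourier_mono; case: (n == j); rewrite ?mulr1 ?mulr0.
have Lm (c : C) (j : int) : L1 (fun t => c * (t ^ j * 1)).
  by apply: (@cintZ _ c (fun x => e x ^ j * 1)); apply: eq_cint (cint_circ R j) => x _; rewrite mulr1.
have en x : e x != 0 by exact: circ_neq0.
case: ks => -[kE sE].
- have D := DomD Dm Dp; exists (fun t => (-1) * (t ^ (-1) * 1) + s * (t ^ 1 * 1)); split => //.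
  + apply: build => // x; rewrite /sym /Jop kE sE !exprN1 !expr1z; field.
    by rewrite en.
  + move=> n n1; rewrite fourierD// !fm (lt_eqF n1) add0r.
    by rewrite lt_eqF// (lt_trans n1).
  + by rewrite fourierD// !fm /= addr0.
- exists (fun t => (-1) * (t ^ (-1) * 1)); split => //.
  + apply: build => // x; rewrite /sym /Jop kE sE !exprN1; field.
    by rewrite en.
  + by move=> n n1; rewrite fm (lt_eqF n1).
all: have D := DomD Dm Dc; exists (fun t => (-1) * (t ^ (-1) * 1) + s * 1).
all: have Lc : L1 (fun=> s * 1) by exact: cint_cst.
all: split => //;
  [apply: build => // x; rewrite /sym /Jop kE sE !exprN1 expr0z; field; by rewrite en
  |move=> n n1; rewrite fourierD// fm fourier_cst (lt_eqF n1) add0r;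
   by rewrite lt_eqF// (lt_trans n1)
  |by rewrite fourierD// fm fourier_cst /= addr0].
Qed.

Let S f : Prop := Hp p f /\ Dom f.

Let S_step f : S f -> exists g, S g /\ forall n, coef g n = coef f (n - 1) + coef f (n + 1).
Proof.
move=> [[fp fn] fD]; have [h [hD h0 hn h1]] := kappa.
have [hp _ _] := hD.
have D1 := DomD (Dom_shift1 fD) (Dom_shiftN1 fD).
have Dh := DomZ (fourier f 0) hD.
have [l1 _ _] := Dom_shift1 fD; have [l2 _ _] := Dom_shiftN1 fD.
have [l12 _ _] := D1; have [lh _ _] := Dh.
have D := DomD D1 Dh; have [l _ _] := D.
exists (fun t => t ^ 1 * f t + t ^ (-1) * f t + fourier f 0 * h t); split.
  split; last exact: D.
  split; first exact: l.
  move=> n n0.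
  rewrite fourierD; [|exact: (L1p l12)|exact: (L1p lh)].
  rewrite fourierD; [|exact: (L1p l1)|exact: (L1p l2)].
  rewrite !fourier_shift fourierZ; last exact: (L1p hp).
  rewrite opprK fn ?add0r; last by rewrite (lt_trans _ n0)// gtrBl.
  (* At -1 the coefficient f_0 of t^-1 f cancels against f_0 times the coefficient -1 of [kappa];
     below -1 neither contributes. *)
  have [->|nn] := eqVneq n (-1); first by rewrite h1 addNr mulrN1 subrr.
  have n1 : n < -1 by rewrite lt_neqAle nn -ltzD1 addNr.
  by rewrite hn// mulr0 addr0 fn// -ltrBrDr sub0r.
move=> n; rewrite coefD; [|exact: l12|exact: lh].
rewrite coefD; [|exact: l1|exact: l2].
rewrite coefZ; last exact: hp.
rewrite h0 mulr0 addr0 !coef_shift opprK /coef; ring.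
Qed.

(** * From a nonzero kernel element to a dense range *)

Section Kernel.
Variable f0 : C -> C.
Hypothesis f0S : S f0.
Hypothesis f0_ker : forall n : int, 0 <= n -> coef f0 n = 0.
Hypothesis f0_neq0 : lpint p f0 <> 0%E.

(** If every [coef] vanished, uniqueness and the inverse of a would give f0 + s t^k J f0 = 0, that
    is f_n + s f_m = 0 with m = k - 1 - n. For n > 0 the index m is negative, so f_n = 0. *)
Let coef_f0_neq0 : exists r : nat, coef f0 (- r%:Z) != 0.
Proof.
apply: contrapT => nex; apply: f0_neq0.
have [[fp fn] _] := f0S.
have c0 n : coef f0 n = 0.
  case: n => n; first exact: f0_ker.
  rewrite NegzE; apply/eqP/negPn/negP => h.
  by apply: nex; exists n.+1.
have sp := Lp_sym fp; have asp := Lpa sp.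
have as0 : aeT (fun x => a (e x) * sym f0 (e x) = 0).
  by apply: (@fourier_uniq _ (fun t => a t * sym f0 t) (L1p asp)) => n; rewrite -coefE.
have s0 : aeT (fun x => sym f0 (e x) = 0).
  have [_ [b' [_ ab]]] := aG.
  apply: (aeT_imp2 _ as0 ab) => x _ h1 h2.
  by rewrite -[LHS]mul1r -h2 mulrAC h1 mul0r.
have fs n : fourier (sym f0) n = 0.
  rewrite (@ae_fourier _ _ (fun=> 0)); [by rewrite fourier_cst mul0rn| | |exact: s0].
    by case: sp.
  exact: cmeas_cst.
have fE n : fourier f0 n + s * fourier f0 (- (n - k + 1)) = 0.
  rewrite -(fs n) -fourier_Jop; last exact: L1p.
  rewrite -fourier_shift -fourierZ; last exact: (L1p (Lp_shift k p0 (Lp_Jop p0 fp))).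
  rewrite -fourierD; [|exact: L1p|exact: (L1p (LpZ s p0 (Lp_shift k p0 (Lp_Jop p0 fp))))].
  by apply: eq_fourier => x; rewrite /sym mulrA.
apply/(lpint0P (lt_trans ltr01 p1) fp).
apply: (fourier_uniq (L1p fp)) => n.
have [n0|n0] := ltP n 0; first exact: fn.
have := fE n.
have [->|nn] := eqVneq n 0.
  (* At n = 0 the partner index is k - 1. It is 0 for k = 1, where s = 1 gives 2 f_0 = 0, and
     negative in the other cases. *)
  case: ks => -[kE sE]; rewrite kE sE ?sub0r ?subr0 ?add0r ?addNr ?opprK ?oppr0.
  - rewrite mul1r -mulr2n => /eqP; rewrite mulrn_eq0 /= => /eqP//.
  - by rewrite (fn (- _))// mulr0 addr0.
  - by rewrite (fn (- _))// mulr0 addr0.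
  - by rewrite (fn (- _))// mulr0 addr0.
have n1 : 0 < n by rewrite lt_neqAle eq_sym nn.
rewrite [X in _ + s * X](fn _) ?mulr0 ?addr0//.
rewrite oppr_lt0; case: ks => -[-> _]; rewrite ?subrK ?subr0 ?opprK//.
- by rewrite ltr_wpDr// ltr_wpDr.
- by rewrite ltr_wpDr.
- by rewrite ltr_wpDr.
Qed.

Let top_degree : exists r : nat, [/\ coef f0 (- r%:Z) != 0 &
  forall n : int, - r%:Z < n -> coef f0 n = 0].
Proof.
have [r cr rmin] := ex_minnP coef_f0_neq0.
exists r; split => // n rn; case: n rn => n rn; first exact: f0_ker.
apply/eqP/negPn/negP; rewrite NegzE => h.
by have := rmin _ h; rewrite leqNgt -ltz_nat -ltrN2 -NegzE rn.
Qed.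

(** In the recursion of [S_step] only the old top coefficient reaches the new top index, so it is
    carried over unchanged and stays nonzero. *)
Let iterate : exists r : nat, forall i : nat, exists g, [/\ S g,
  coef g (i%:Z - r%:Z) != 0 & forall n : int, i%:Z - r%:Z < n -> coef g n = 0].
Proof.
have [r [cr rz]] := top_degree; exists r; elim=> [|i [g [gS gc gz]]].
  by exists f0; rewrite sub0r.
have [g' [gS' gE]] := S_step gS.
exists g'; split=> // [|n ni].
  rewrite gE (_ : i.+1%:Z - r%:Z - 1 = i%:Z - r%:Z); last by lia.
  by rewrite [X in _ + X]gz ?addr0//; lia.
by rewrite gE !gz ?addr0//; lia.
Qed.

(** Triangular elimination: an element with top coefficient exactly at d settles [c d], and the
    induction hypothesis supplies the lower coefficients, corrected by what that element
    contributes. *)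
Let interpolate (d : nat) : forall c : nat -> C, exists f, S f /\
  forall n : nat, coef f n = if (n < d)%N then c n else 0.
Proof.
have [r hr] := iterate.
elim: d => [|d ih] c.
  have [g [[gH gD] _ _]] := hr 0%N; have [gp _ _] := gD.
  exists (fun t => 0 * g t); split; first by split; [exact: (HpZ p1)|exact: DomZ].
  by move=> n; rewrite coefZ ?mul0r.
(* From -r, the index d + r puts the top coefficient at d. *)
have [g [[gH gD]]] := hr (d + r)%N.
rewrite PoszD addrK => gc gz; have [gp _ _] := gD.
pose l := c d / coef g d.
have [f [[fH fD] fc]] := ih (fun n => c n - l * coef g n).
have [fp _ _] := fD.
have lp := LpZ l p0 gp.
exists (fun t => f t + l * g t); split.
  split; first by apply: (HpD p1 fH); exact: (HpZ p1).
  exact: (DomD fD (DomZ l gD)).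
move=> n; rewrite (@coefD _ _ n fp lp) (@coefZ l _ n gp) fc ltnS; case: (ltngtP n d) => nd.
- by rewrite subrK.
- by rewrite add0r gz ?mulr0// ltz_nat.
- by rewrite nd add0r /l divfK.
Qed.

(** For f in H^p the function J f has only negative frequencies, so J f itself serves as Q J f in
    [Hank]. *)
Let S_TH f : S f -> exists G, [/\ TH_op p a s b f G, Hp p G &
  forall n : int, 0 <= n -> fourier G n = coef f n].
Proof.
move=> [[fp fn] [_ [g1 g1P] [g2 g2P]]].
have [g1H g1f] := g1P; have [g2H g2f] := g2P.
exists (fun t => g1 t + s * g2 t); split.
- exists g1, g2; split; first exact: g1P.
  split => //; exists (Jop f); split; last exact: g2P.
  split; first exact: (Lp_Jop p0 fp).
  split => // n n0; rewrite fourier_Jop; last exact: L1p.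
  by rewrite fn// oppr_lt0 ltr_wpDl.
- by apply: (HpD p1 g1H); exact: (HpZ p1).
- move=> n n0; have [g1p _] := g1H; have [g2p _] := g2H.
  rewrite fourierD; [|exact: L1p|exact: (L1p (LpZ s p0 g2p))].
  rewrite fourierZ; last exact: L1p.
  by rewrite g1f// g2f.
Qed.

(** A Fejer mean of h is attained exactly: [interpolate] prescribes all its nonnegative
    coefficients, and uniqueness identifies the image with it almost everywhere. *)
Lemma coker_trivial_of_kernel : coker_trivial p a s b.
Proof.
move=> h [hp hn] eps e0.
have pi2 := pi2_gt0 R.
(* [lpint] is 2 pi times the normalised mean, whence eps / (2 pi). *)
have [N hN] := fejer_Lp p1 hp (divr_gt0 e0 pi2).
pose q := fejer N.+1 h.
have qp : Lp p q by exact: (Lp_fejer _ _ p0).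
have [f [fS fc]] := interpolate N.+1 (fun n => fourier q n%:Z).
have [G [GT [Gp Gn] Gc]] := S_TH fS.
exists f, G; split; first by case: fS.
split => //.
have Gq : aeT (fun x => G (e x) = q (e x)).
  apply: (fourier_inj (L1p Gp) (L1p qp)); case=> n.
    rewrite Gc// fc; case: ltnP => // nN.
    by rewrite fourier_fejer_high.
  by rewrite Gn// fourier_fejer0// hn.
have dp := LpB p0 qp hp; have dG := LpB p0 Gp hp.
rewrite (lpint_mean dG) lte_fin.
rewrite (@ae_mean _ _ (fun x => cabs (q (e x) - h (e x)) `^ p)).
- by rewrite mulrC -ltr_pdivlMr//; exact: hN.
- by apply: measurable_cabs_powR; case: dG.
- by apply: measurable_cabs_powR; case: dp.
- by apply: aeT_imp Gq => x _ ->.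
Qed.

End Kernel.

(** A failure of [ker_trivial] comes with witnesses of [TH_op], and these are the projections that
    place [f0] in [Dom]. *)
Lemma ker_or_coker_trivial : ker_trivial p a s b \/ coker_trivial p a s b.
Proof.
have [|nk] := pselect (ker_trivial p a s b); first by left.
right; move/existsNP : nk => [f0] /existsNP[g] /not_implyP[fH] /not_implyP[fT].
move=> /not_implyP[g0 f0n].
have [g1 [g2 [[g1H g1f] [[q [[qp [q1 q2]] [g2H g2f]]] gE]]]] := fT.
have [fp fn] := fH.
have [g1p _] := g1H; have [g2p _] := g2H.
(* The witness q has the coefficients of J f0, since f0 is analytic; uniqueness allows replacing q
   by J f0. *)
have qJ : aeT (fun x => q (e x) = Jop f0 (e x)).
  apply: (fourier_inj (L1p qp) (L1p (Lp_Jop p0 fp))) => n.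
  have [n0|n0] := ltP n 0; first exact: (q2 n n0).
  have n1 : - (n + 1) < 0 by rewrite oppr_lt0 ltr_wpDl.
  by rewrite (q1 n n0) (fourier_Jop n (L1p fp)) (fn _ n1).
have bq n : fourier (fun t => b t * q t) n = fourier (fun t => b t * Jop f0 t) n.
  apply: ae_fourier.
  - by have [] := Lp_mul_inf p0 bI qp.
  - by have [] := LpbJ fp.
  - by apply: aeT_imp qJ => x _ ->.
apply: (@coker_trivial_of_kernel f0); last exact: f0n.
  split; first exact: fH.
  split; [exact: fp|by exists g1; exact: (conj g1H g1f)|].
  by exists g2; split; [exact: g2H|move=> n n0; rewrite (g2f n n0) bq].
have sp := LpZ s p0 g2p; have gp := LpD p0 g1p sp.
have gp' : Lp p g by apply: eq_Lp gp => x; rewrite gE.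
have gz : aeT (fun x => g (e x) = 0) by apply/(lpint0P (lt_trans ltr01 p1) gp').
move=> n n0; rewrite /coef -(g1f n n0) -bq -(g2f n n0) -(fourierZ s n (L1p g2p)).
rewrite -(fourierD n (L1p g1p) (L1p sp)).
rewrite (@ae_fourier _ _ (fun=> 0)); [by rewrite fourier_cst mul0rn| | |].
- by case: gp.
- exact: cmeas_cst.
- by apply: aeT_imp gz => x _; rewrite gE.
Qed.

End Operator.
End ToeplitzHankel.

Theorem theorem2p9 (R : realType) (p : R) (a : R[i] -> R[i])
  (hp1 : 1 < p) (ha : GLinf a) (s : R[i]) (b : R[i] -> R[i])
  (hA : [\/ s = 1 /\ b = (fun t => a t * t),
           s = -1 /\ b = (fun t => a t * t^-1),
           s = 1 /\ b = a
         | s = -1 /\ b = a]) :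
  ker_trivial p a s b \/ coker_trivial p a s b.
Proof.
have [k ks ->] : exists2 k : int,
    [\/ k = 1 /\ s = 1, k = -1 /\ s = -1, k = 0 /\ s = 1 | k = 0 /\ s = -1] &
    b = (fun t => a t * t ^ k).
  case: hA => -[-> ->].
  - by exists 1; [exact: Or41|apply/funext => t; rewrite expr1z].
  - by exists (-1); [exact: Or42|apply/funext => t; rewrite exprN1].
  - by exists 0; [exact: Or43|apply/funext => t; rewrite expr0z mulr1].
  - by exists 0; [exact: Or44|apply/funext => t; rewrite expr0z mulr1].
exact: ker_or_coker_trivial.
Qed.
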